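(* Let $n\ge 2$ and let $\mu$ be a locally finite Borel measure on $\mathbb{R}^n$ such that $(\mathrm{M}_1\mu)(x_0)<\infty$ for some $x_0\in\mathbb{R}^n$. Then there is a constant $C>0$, depending only on $n$ and the $\mathrm{A}_1$ constant of $\mathrm{M}_1\mu$, such that for every open set $\Omega\subseteq\mathbb{R}^n$ with finite $\mathrm{M}_1\mu$-perimeter, $$\mu(\Omega)\le C\,\mathrm{Per}(\Omega,\mathrm{M}_1\mu).$$
   Context: A locally finite Borel measure on $\mathbb{R}^n$ is a positive Borel measure $\mu$ with $\mu(K)<\infty$ for every compact $K$. $\mathcal{L}$ denotes Lebesgue measure, and $\mathrm{M}_1\mu(x)=\sup_{r>0} r\,\mu(B_r(x))/\mathcal{L}(B_r(x))$; $\mathrm{M}$ denotes the Hardy–Littlewood maximal operator $\mathrm{M}w(x)=\sup_{r>0}\frac1{\mathcal L(B_r(x))}\int_{B_r(x)}|w|\,dy$. A weight is a nonnegative locally integrable function; a nonzero weight $w$ is in $\mathrm{A}_1$ if $\mathrm{M}w(x)\le c\,w(x)$ for all $x\in\mathbb{R}^n$, the best $c$ being its $\mathrm{A}_1$ constant. It is known that if $\mu\neq0$ and $\mathrm{M}_1\mu$ is finite at some point, then $\mathrm{M}_1\mu$ is lower semicontinuous and belongs to $\mathrm{A}_1$. Weighted BV and perimeter: for a positive lower semicontinuous weight $w$, a function $u\in L^1(w)$ belongs to $\mathrm{BV}(w)$ if $$|Du|_w(\mathbb{R}^n):=\sup\Big\{\int_{\mathbb{R}^n}u\,\mathrm{div}\,\boldsymbol\Phi\,dx:\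 \boldsymbol\Phi\in C^1_c(\mathbb{R}^n,\mathbb{R}^n),\ |\boldsymbol\Phi(x)|\le w(x)\ \text{for all }x\Big\}<\infty.$$ A measurable set $\Omega$ has finite $w$-perimeter if $\mathbf{1}_\Omega\in\mathrm{BV}(w)$, and then $\mathrm{Per}(\Omega,w):=|D\mathbf{1}_\Omega|_w(\mathbb{R}^n)$. *)

(* Defs.v *)
From HB Require Import structures.
From mathcomp Require Import all_boot all_order all_algebra.
From mathcomp Require Import all_classical all_reals all_analysis.

Set Implicit Arguments.
Unset Strict Implicit.
Unset Printing Implicit Defensive.

Import Order.TTheory GRing.Theory Num.Theory.
Import numFieldTopology.Exports numFieldNormedType.Exports.

Local Open Scope classical_set_scope.
Local Open Scope ring_scope.

(* R^n is 'rV[R]_n with its Borel sigma-algebra. The library's norm on 'rV[R]_n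
   is the sup norm: only its topology and its notion of differentiability are
   used, balls and lengths of vectors being Euclidean. *)
Section borel_rV.
Variables (R : realType) (n : nat).

HB.instance Definition _ := @isMeasurable.Build
  (sigma_display (@open 'rV[R]_n)) 'rV[R]_n
  <<s (@open 'rV[R]_n) >> (@sigma_algebra0 _ setT open) (@sigma_algebraC _ open)
  (@sigma_algebra_bigcup _ setT open).

Lemma open_measurable_rV (U : set 'rV[R]_n) : open U -> measurable U.
Proof. by move=> oU; exact: sub_sigma_algebra. Qed.

Lemma measurable_fun_coord i :
  measurable_fun [set: 'rV[R]_n] (fun v => v 0 i : measurableTypeR R).
Proof.
apply: (measurability _ (measurable_realfun.RGenOpens.measurableE R)) => _ [_ [a [b ->]] <-].
rewrite setTI; apply: open_measurable_rV.
by move/continuousP: (@coord_continuous R 1 n 0 i); apply; exact: interval_open.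
Qed.

Lemma measurable_fun_rV d (T : measurableType d) (f : T -> 'rV[R]_n) :
    (forall i, measurable_fun setT (fun x => f x 0 i : measurableTypeR R)) ->
  measurable_fun setT f.
Proof.
move=> mf; apply: (@measurability _ _ _ _ setT f open) => //.
move=> _ [U oU <-]; rewrite setTI.
pose I := ('rV[rat]_n * rat)%type.
pose B (p : I) : set 'rV[R]_n := ball (map_mx ratr p.1 : 'rV[R]_n) (ratr p.2).
pose F (k : nat) : set T := if unpickle k is Some p then
  [set x | `[< B p `<=` U >] /\ B p (f x)] else set0.
rewrite (_ : f @^-1` U = \bigcup_k F k).
  apply: bigcup_measurable => k _; rewrite /F.
  case: (unpickle k) => [p|]; last exact: measurable0.
  case: (asboolP (B p `<=` U)) => BU; last first.
    by rewrite (_ : [set _ | _] = set0)//; apply/seteqP; split => x // [].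
  have [q0|q0] := ltP 0 (ratr p.2 : R); last first.
    rewrite (_ : [set _ | _] = set0)//; apply/seteqP; split => x // [_].
    by move=> [+ _]; rewrite ltNge q0.
  rewrite (_ : [set _ | _] = \bigcap_(i in [set: 'I_n])
      ((fun x => f x 0 i) @^-1` ball (ratr (p.1 0 i) : R) (ratr p.2))).
    apply: fin_bigcap_measurable => [|i _]; first exact: finite_finset.
    by rewrite -[X in measurable X]setTI; apply: mf => //; exact: measurable_realfun.measurable_ball.
  apply/seteqP; split => x /=; first by move=> [_ [_ +]] i _ => /(_ 0 i); rewrite mxE.
  by move=> fx; split=> //; split=> // j i; rewrite ord1 mxE; exact: fx.
apply/seteqP; split => x /=; last first.
  move=> [k _]; rewrite /F; case: (unpickle k) => [p|] //= [/asboolP]; exact.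
move=> Ufx.
have [e /= e0 eU] : nbhs_ball (f x) U by apply/nbhs_ballP; exact: open_nbhs_nbhs.
have [q] : exists q : rat, ratr q \in `]0, (e / 2)[ by apply/rat_in_itvoo; rewrite divr_gt0.
rewrite in_itv/= => /andP[q0 qe].
have /choice[c cP] i : exists c : rat, ratr c \in `](f x 0 i), (f x 0 i + ratr q)[.
  by apply: rat_in_itvoo; rewrite ltrDl.
pose p : I := (\row_i c i, q).
have Bfx : B p (f x).
  split=> // j i; rewrite ord1 !mxE /ball/= ger0_norm.
    by have := cP i; rewrite in_itv/= ltrBlDl => /andP[].
  by have := cP i; rewrite in_itv/= subr_ge0 => /andP[/ltW].
exists (pickle p) => //; rewrite /F pickleK; split=> //; apply/asboolP => y By.
apply: eU; apply: (@le_ball _ _ _ (ratr q + ratr q)).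
  by rewrite -mulr2n -mulr_natr -ler_pdivlMr// ltW.
by apply: ball_triangle By; apply: ball_sym.
Qed.

End borel_rV.

(* Lebesgue measure on R^n, as the n-fold product of the Lebesgue measure on R:
   consV and unconsV are the identification R * R^n = R^(n+1). *)
Section lebesgue_measure_rV.
Variable R : realType.

Definition consV n (p : measurableTypeR R * 'rV[R]_n) : 'rV[R]_n.+1 :=
  \row_i oapp (p.2 0) p.1 (unlift ord0 i).

Definition unconsV n (v : 'rV[R]_n.+1) : measurableTypeR R * 'rV[R]_n :=
  (v 0 ord0, \row_i v 0 (lift ord0 i)).

Lemma consVK n : cancel (@consV n) (@unconsV n).
Proof.
move=> [a v]; congr (_, _); first by rewrite mxE unlift_none.
by apply/rowP => i; rewrite !mxE liftK.
Qed.

Lemma measurable_consV n : measurable_fun setT (@consV n).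
Proof.
apply: measurable_fun_rV => i.
have -> : (fun p => @consV n p 0 i : measurableTypeR R) =
    (fun p => oapp (p.2 0) p.1 (unlift ord0 i)).
  by apply/funext => p; rewrite mxE.
case: (unlift _ _) => [j|] /=; last exact: measurable_fst.
exact: (measurableT_comp (@measurable_fun_coord R n j) measurable_snd).
Qed.

Lemma measurable_unconsV n : measurable_fun setT (@unconsV n).
Proof.
apply/measurable_fun_pairP; split; first exact: measurable_fun_coord.
apply: measurable_fun_rV => i.
have -> : (fun v => (@unconsV n v).2 0 i : measurableTypeR R) =
    (fun v => v 0 (lift ord0 i)).
  by apply/funext => v; rewrite mxE.
exact: measurable_fun_coord.
Qed.

Section step.
Variables (n : nat) (m : {sigma_finite_measure set 'rV[R]_n -> \bar R}).

Definition lebesgue_rV_step : set 'rV[R]_n.+1 -> \bar R :=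
  pushforward (@lebesgue_measure R \x m)%E (@consV n).

Let step0 : lebesgue_rV_step set0 = 0%E.
Proof. by rewrite /lebesgue_rV_step /pushforward preimage_set0 measure0. Qed.

Let step_ge0 A : (0 <= lebesgue_rV_step A)%E.
Proof. by apply: measure_ge0; exact: measurable_consV. Qed.

Let step_sigma_additive : semi_sigma_additive lebesgue_rV_step.
Proof. by apply: measure_semi_sigma_additive; exact: measurable_consV. Qed.

HB.instance Definition _ := isMeasure.Build _ _ _ lebesgue_rV_step
  step0 step_ge0 step_sigma_additive.

Let lebesgue_rV_step_sigma_finite : sigma_finite setT lebesgue_rV_step.
Proof.
(* named, since canonical inference on \x only finds the subprobability case *)
have [F UF mF] := isSigmaFinite.sigma_finiteT
  (lebesgue_integral_fubini.measure_function_Measure_isSigmaFinite__to__measure_function_isSigmaFinite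
    (@lebesgue_measure R) m).
exists (fun k => @unconsV n @^-1` F k).
  by rewrite -preimage_bigcup -UF preimage_setT.
move=> k; have [mFk Foo] := mF k; split.
  by rewrite -[X in measurable X]setTI; exact: measurable_unconsV.
rewrite /lebesgue_rV_step /pushforward -comp_preimage.
by rewrite (_ : _ \o _ = idfun)//; apply/funext; exact: consVK.
Qed.

HB.instance Definition _ := Measure_isSigmaFinite.Build _ _ _
  lebesgue_rV_step lebesgue_rV_step_sigma_finite.

End step.

Fixpoint lebesgue_measure_rV n : {sigma_finite_measure set 'rV[R]_n -> \bar R} :=
  if n is n'.+1 then lebesgue_rV_step (lebesgue_measure_rV n')
  else @dirac _ 'rV[R]_0 0 R.

Lemma lebesgue_measure_rV_prod n (A : 'I_n -> set (measurableTypeR R)) :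
    (forall i, measurable (A i)) ->
  lebesgue_measure_rV n [set v | forall i, A i (v 0 i)] =
  (\prod_(i < n) lebesgue_measure (A i))%E.
Proof.
elim: n A => [|n IHn] A mA /=.
  by rewrite big_ord0 diracE mem_set// => -[].
rewrite big_ord_recl/= -IHn//.
rewrite -product_measure1E//; last first.
  rewrite (_ : [set _ | _] =
      \bigcap_(i in [set: 'I_n]) ((fun v => v 0 i) @^-1` A (lift ord0 i))).
    apply: fin_bigcap_measurable => [|i _]; first exact: finite_finset.
    rewrite -[X in measurable X]setTI.
    exact: (@measurable_fun_coord R n i measurableT _ (mA _)).
  by apply/seteqP; split => x /= Ax; move=> *; exact: Ax.
rewrite /lebesgue_rV_step /pushforward.
apply: (congr1 (product_measure1 _ _)); apply/seteqP; split => -[a v] /=.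
  move=> Av; split; first by have := Av ord0; rewrite mxE unlift_none.
  by move=> i; have := Av (lift ord0 i); rewrite mxE liftK.
move=> [Aa Av] i; rewrite mxE; case: unliftP => [j ->|->] //=; exact: Av.
Qed.

End lebesgue_measure_rV.

Section weighted_perimeter.
Variables (R : realType) (n : nat).
Local Open Scope ereal_scope.
Local Notation leb := (lebesgue_measure_rV R n).

Definition euclidean_norm (v : 'rV[R]_n) : R :=
  Num.sqrt (\sum_(i < n) v 0 i ^+ 2)%R.

Definition euclidean_ball (x : 'rV[R]_n) (r : R) : set 'rV[R]_n :=
  [set y | (euclidean_norm (y - x) < r)%R].

Definition locally_finite_measure (mu : {measure set 'rV[R]_n -> \bar R}) :=
  forall K : set 'rV[R]_n, compact K -> mu K < +oo.

Definition M1 (mu : {measure set 'rV[R]_n -> \bar R}) (x : 'rV[R]_n) : \bar R :=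
  ereal_sup [set r%:E * mu (euclidean_ball x r) / leb (euclidean_ball x r)
            | r in [set r : R | (0 < r)%R]].

(* Weights are extended-real-valued because M1 mu may take the value +oo, for
   instance at an atom of mu. *)
Definition HL_maximal_rV (w : 'rV[R]_n -> \bar R) (x : 'rV[R]_n) : \bar R :=
  ereal_sup [set (\int[leb]_(y in euclidean_ball x r) `|w y|) /
                 leb (euclidean_ball x r)
            | r in [set r : R | (0 < r)%R]].

Definition A1_constant (w : 'rV[R]_n -> \bar R) : \bar R :=
  ereal_inf [set c%:E | c in
    [set c : R | (0 <= c)%R /\ forall x, HL_maximal_rV w x <= c%:E * w x]].

Definition C1_compact_support (Phi : 'rV[R]_n -> 'rV[R]_n) :=
  [/\ forall x, differentiable Phi x,
      continuous (jacobian Phi) &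
      compact (closure [set x | Phi x != 0%R])].

Definition divergence (Phi : 'rV[R]_n -> 'rV[R]_n) (x : 'rV[R]_n) : R :=
  (\sum_(i < n) 'D_(delta_mx 0 i) (fun y => Phi y 0 i) x)%R.

Definition total_variation_wgt (w : 'rV[R]_n -> \bar R) (u : 'rV[R]_n -> R)
    : \bar R :=
  ereal_sup [set \int[leb]_x (u x * divergence Phi x)%:E
            | Phi in [set Phi | C1_compact_support Phi /\
                forall x, (euclidean_norm (Phi x))%:E <= w x]].

Definition L1_wgt (w : 'rV[R]_n -> \bar R) (u : 'rV[R]_n -> R) :=
  measurable_fun setT u /\ \int[leb]_x (`|u x|%:E * w x) < +oo.

Definition BV_wgt (w : 'rV[R]_n -> \bar R) (u : 'rV[R]_n -> R) :=
  L1_wgt w u /\ total_variation_wgt w u < +oo.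

Definition perimeter (Omega : set 'rV[R]_n) (w : 'rV[R]_n -> \bar R) : \bar R :=
  total_variation_wgt w \1_Omega.

Definition finite_perimeter (Omega : set 'rV[R]_n) (w : 'rV[R]_n -> \bar R) :=
  measurable Omega /\ BV_wgt w \1_Omega.

End weighted_perimeter.

(* Main.v *)
(* The constant comes from covering [Omega] by critical cubes, i.e. cubes
   [Q_r(x)] in which [Omega] has a small but non-negligible density. They exist
   because [M1 mu] decays at most like [|y|^(1 - n)], so that finiteness of its
   integral over [Omega] forces the density of [Omega] in large cubes to vanish.

   In a critical cube the relative isoperimetric inequality is proved by duality,
   by exhibiting a field [phi] supported in the cube, with [|phi| <= n r], and
   such that [int_Omega div phi >= c |Omega /\ Q_r(x)|]. Pack [Omega /\ Q_r(x)]
   with small disjoint cubes [Q_j]; [phi] transports the sum of the bumps of the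
   [Q_j] onto a multiple of the bump of [Q_r(x)], one coordinate at a time. The
   divergence is then the difference of the two densities, the first of which
   lives in [Omega] whereas the second is mostly outside of [Omega]; the bound on
   [phi] is a count of the cubes [Q_j] meeting a coordinate slice.

   Vitali's lemma extracts disjoint critical cubes [Q_i] with
   [mu Omega <~ sum_i mu (3 Q_i)], and [mu (3 Q_i) <~ r_i^(n - 1) inf_(Q_i) M1 mu]
   makes [sum_i lam_i phi_i], with [lam_i] of order [mu (3 Q_i) / r_i^n], an
   admissible field in the definition of the perimeter. *)
Require Import Defs.
From mathcomp Require Import all_boot all_order all_algebra.
From mathcomp Require Import all_classical all_reals all_analysis.
From mathcomp Require Import measurable_realfun ring lra.
Import Order.TTheory GRing.Theory Num.Theory.
Import numFieldTopology.Exports numFieldNormedType.Exports.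
Local Open Scope classical_set_scope.
Local Open Scope ring_scope.
Set Implicit Arguments.
Unset Strict Implicit.
Unset Printing Implicit Defensive.

(** * Calculus of scalar functions of class C^1 *)

Section C1_functions.
Context {R : realType} {V : normedModType R}.
Implicit Types f g : V -> R.

(** Continuity is asked of every directional derivative separately: these are what the divergence
    and the entries of the Jacobian are made of. *)
Definition C1_fun f :=
  (forall x, differentiable f x) /\ forall v, continuous ('D_v f).

Lemma C1_fun_continuous f : C1_fun f -> continuous f.
Proof. by move=> [df _] x; exact: differentiable_continuous. Qed.

Lemma C1_fun_cst (c : R) : C1_fun (fun=> c).
Proof.
split=> [x|v]; first exact: differentiable_cst.
rewrite (_ : 'D_v _ = cst 0); first exact: cst_continuous.
by apply/funext => x; exact: derive_cst.
Qed.

Lemma C1_funD f g : C1_fun f -> C1_fun g -> C1_fun (fun x => f x + g x).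
Proof.
move=> [df cf] [dg cg]; split=> [x|v]; first exact: differentiableD.
rewrite (_ : 'D_v _ = (fun x => 'D_v f x + 'D_v g x)).
  by move=> x; apply: cvgD; [exact: cf|exact: cg].
by apply/funext => x; apply: deriveD; exact: diff_derivable.
Qed.

Lemma C1_funM f g : C1_fun f -> C1_fun g -> C1_fun (fun x => f x * g x).
Proof.
move=> Cf Cg; have [df cf] := Cf; have [dg cg] := Cg.
split=> [x|v]; first exact: differentiableM.
rewrite (_ : 'D_v _ = (fun x => f x * 'D_v g x + g x * 'D_v f x)).
  move=> x; apply: cvgD; apply: cvgM; first exact: C1_fun_continuous.
  - exact: cg.
  - exact: C1_fun_continuous.
  - exact: cf.
by apply/funext => x; apply: deriveM; exact: diff_derivable.
Qed.

Lemma C1_fun_sum (I : Type) (s : seq I) (F : I -> V -> R) :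
  (forall i, C1_fun (F i)) -> C1_fun (fun x => \sum_(i <- s) F i x).
Proof.
move=> CF; elim: s => [|i s IH].
  under eq_fun do rewrite big_nil; exact: C1_fun_cst.
under eq_fun do rewrite big_cons; exact: C1_funD.
Qed.

Lemma C1_fun_prod (I : finType) (P : pred I) (F : I -> V -> R) :
  (forall i, C1_fun (F i)) -> C1_fun (fun x => \prod_(i | P i) F i x).
Proof.
move=> CF; elim: (index_enum I) => [|i s IH].
  under eq_fun do rewrite big_nil; exact: C1_fun_cst.
under eq_fun do rewrite big_cons; case: (P i) => //; exact: C1_funM.
Qed.

Lemma C1_funB f g : C1_fun f -> C1_fun g -> C1_fun (fun x => f x - g x).
Proof.
move=> Cf Cg; under eq_fun do rewrite -mulN1r.
by apply: C1_funD => //; apply: C1_funM => //; exact: C1_fun_cst.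
Qed.

Lemma derive_scalar_comp (g : R -> R) (dg : R) f x v :
  is_derive (f x) (1:R) g dg -> differentiable f x ->
  'D_v (fun x => g (f x)) x = 'D_v f x * dg.
Proof.
move=> dgx dfx; have dg' : differentiable g (f x) by apply/derivable1_diffP.
rewrite deriveE; last exact: differentiable_comp.
rewrite (_ : (fun x => g (f x)) = g \o f)// diff_comp//= (deriveE v dfx).
by rewrite deriv1E// derive1E derive_val.
Qed.

Lemma C1_fun_comp (g : R -> R) (g' : R -> R) f :
  (forall t, is_derive t (1:R) g (g' t)) -> continuous g' ->
  C1_fun f -> C1_fun (fun x => g (f x)).
Proof.
move=> dg cg Cf; have [df cf] := Cf.
split=> [x|v].
  by apply: differentiable_comp => //; apply/derivable1_diffP.
rewrite (_ : 'D_v _ = (fun x => 'D_v f x * g' (f x))).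
  move=> x; apply: cvgM; first exact: cf.
  apply: continuous_comp; first exact: C1_fun_continuous.
  exact: cg.
by apply/funext => x; exact: derive_scalar_comp.
Qed.

End C1_functions.

(** * A C^1 bump on the line and its primitive *)

Section quadratic_spline.
Context {R : realType}.
Implicit Types t : R.

(** A quadratic remainder is [o(h)]. This treats truncated powers at their kink and away from it by
    the same polynomial inequalities, without gluing one-sided derivatives. *)
Lemma is_derive_taylor (f : R -> R) t l C :
  (forall h, `|h| <= 1 -> `|f (h + t) - f t - l * h| <= C * h ^+ 2) ->
  is_derive t (1:R) f l.
Proof.
move=> fC.
suff fl : h^-1 *: (f (h *: 1 + t) - f t) @[h --> 0^'] --> l.
  by apply: DeriveDef; [apply/cvg_ex; exists l|exact/cvg_lim].
apply/cvgrPdist_le => /= e e0; near=> h.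
have h0 : h != 0 by near: h; exact: nbhs_dnbhs_neq.
rewrite /GRing.scale/= mulr1 distrC.
have -> : h^-1 * (f (h + t) - f t) - l = h^-1 * (f (h + t) - f t - l * h).
  by field.
rewrite normrM normfV ler_pdivrMl ?normr_gt0//.
apply: (le_trans (fC _ _)).
  by near: h; exact: dnbhs0_le.
rewrite -(real_normK (num_real h)) expr2 mulrCA ler_wpM2l//.
(* The sign of [C] is unknown, so the division is by [|C| + 1]. *)
have C0 : 0 < `|C| + 1 by rewrite ltr_wpDl.
apply: (@le_trans _ _ ((`|C| + 1) * `|h|)).
  by rewrite ler_wpM2r// (le_trans (ler_norm _))// lerDl.
rewrite mulrC -ler_pdivlMr//; near: h; apply: dnbhs0_le.
by rewrite divr_gt0// ltr_wpDl.
Unshelve. all: by end_near. Qed.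

Definition pos_part t : R := Num.max t 0.

Lemma continuous_pos_part : continuous pos_part.
Proof. by move=> t; apply: continuous_max; [exact: cvg_id|exact: cvg_cst]. Qed.

Lemma is_derive_pos_part2 t :
  is_derive t (1:R) (fun t => pos_part t ^+ 2) (2 * pos_part t).
Proof.
apply: (@is_derive_taylor _ _ _ 2) => h h1.
rewrite ler_norml /pos_part !maxEle.
by case: ifP => /idP H1; case: ifP => /idP H2; apply/andP; split; nra.
Qed.

Lemma is_derive_pos_part3 t :
  is_derive t (1:R) (fun t => pos_part t ^+ 3) (3 * pos_part t ^+ 2).
Proof.
(* When [t] and [h + t] are both positive the remainder is [h ^+ 2 * (3 * t + h)], so the constant
   has to grow with [t]. If the sign changes, [t] or [h + t] is at most [|h|] in absolute value. *)
apply: (@is_derive_taylor _ _ _ (3 * `|t| + 3)) => h h1.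
have := ler_norm t; have := ler_norm (- t); rewrite normrN.
have := normr_ge0 t.
move: `|t| => a a0 ta at_.
move: h1; rewrite !ler_norml /pos_part !maxEle => /andP[h1 h2].
have hh : 0 <= h ^+ 2 := sqr_ge0 h.
case: (leP (h + t) 0) => u0; case: (leP t 0) => t0.
- by apply/andP; split; nra.
- have th : t ^+ 2 <= h ^+ 2 by nra.
  have th3 : 0 <= - t - 3 * h <= 3 by apply/andP; split; lra.
  have [th3' th3''] := andP th3.
  have E1 := mulr_ge0 (sqr_ge0 t) th3'.
  have E2 : t ^+ 2 * (- t - 3 * h) <= h ^+ 2 * 3 by apply: ler_pM => //; exact: sqr_ge0.
  have E3 := mulr_ge0 hh a0.
  by apply/andP; split; nra.
- have uh : (h + t) ^+ 2 <= h ^+ 2 by nra.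
  have E1 : (h + t) ^+ 2 * (h + t) <= h ^+ 2 * 1.
    by apply: ler_pM => //; [exact: sqr_ge0|lra|lra].
  have E2 := mulr_ge0 (sqr_ge0 (h + t)) (ltW u0).
  have E3 := mulr_ge0 hh a0.
  by apply/andP; split; nra.
- have E1 : 0 <= h ^+ 2 * (3 * a + 3 - (3 * t + h)) by apply: mulr_ge0 => //; lra.
  have E2 : 0 <= h ^+ 2 * (3 * a + 3 + (3 * t + h)) by apply: mulr_ge0 => //; lra.
  by apply/andP; split; nra.
Qed.


(* The quadratic B-spline with knots -1, -1/3, 1/3, 1 and its primitive. *)
Definition spline t : R := (pos_part (3 * t + 3) ^+ 2 - 3 * pos_part (3 * t + 1) ^+ 2
  + 3 * pos_part (3 * t - 1) ^+ 2 - pos_part (3 * t - 3) ^+ 2) / 8.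

Definition spline_primitive t : R :=
  (pos_part (3 * t + 3) ^+ 3 - 3 * pos_part (3 * t + 1) ^+ 3
  + 3 * pos_part (3 * t - 1) ^+ 3 - pos_part (3 * t - 3) ^+ 3) / 72.

Let spline' t : R := 3 * (2 * pos_part (3 * t + 3) - 3 * (2 * pos_part (3 * t + 1))
  + 3 * (2 * pos_part (3 * t - 1)) - 2 * pos_part (3 * t - 3)) / 8.

Let is_derive_comp_affine (f : R -> R) (f' : R -> R) (c t : R) :
  (forall t, is_derive t (1:R) f (f' t)) ->
  is_derive t (1:R) (fun t => f (3 * t + c)) (3 * f' (3 * t + c)).
Proof.
move=> df.
have da : is_derive t (1:R) (fun t : R => 3 * t + c) 3.
  apply: (@is_derive_taylor _ _ _ 0) => h _.
  by rewrite mul0r normr_le0; apply/eqP; ring.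
rewrite mulrC; exact: (@is_derive1_comp _ f (fun t => 3 * t + c) t _ 3).
Qed.

Let is_derive_spline t : is_derive t (1:R) spline (spline' t).
Proof.
pose S c t := pos_part (3 * t + c) ^+ 2.
have dS c : is_derive t (1:R) (S c) (3 * (2 * pos_part (3 * t + c))).
  apply: (is_derive_comp_affine (f := fun t => pos_part t ^+ 2)
    (f' := fun t => 2 * pos_part t)).
  exact: is_derive_pos_part2.
rewrite (_ : spline = 8^-1 \*: (S 3 - 3 \*: S 1 + 3 \*: S (- 1) - S (- 3))); last first.
  by apply/funext => u; rewrite /spline mulrC.
apply: is_derive_eq; rewrite /spline' /GRing.scale/=; ring.
Qed.


Lemma is_derive_spline_primitive t : is_derive t (1:R) spline_primitive (spline t).
Proof.
pose S c t := pos_part (3 * t + c) ^+ 3.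
have dS c : is_derive t (1:R) (S c) (3 * (3 * pos_part (3 * t + c) ^+ 2)).
  apply: (is_derive_comp_affine (f := fun t => pos_part t ^+ 3)
    (f' := fun t => 3 * pos_part t ^+ 2)).
  exact: is_derive_pos_part3.
rewrite (_ : spline_primitive =
    72^-1 \*: (S 3 - 3 \*: S 1 + 3 \*: S (- 1) - S (- 3))); last first.
  by apply/funext => u; rewrite /spline_primitive mulrC.
apply: is_derive_eq; rewrite /spline /GRing.scale/=; by field.
Qed.

Lemma C1_fun_spline (V : normedModType R) (f : V -> R) :
  C1_fun f -> C1_fun (fun x => spline (f x)).
Proof.
move=> Cf; apply: (C1_fun_comp is_derive_spline) => //.
have cp c u : {for u, continuous (fun u : R => pos_part (3 * u + c))}.
  apply: continuous_comp; last exact: continuous_pos_part.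
  by apply: cvgD; [apply: cvgM; [exact: cvg_cst|exact: cvg_id]|exact: cvg_cst].
move=> u; apply: cvgM; last exact: cvg_cst.
apply: cvgM; first exact: cvg_cst.
by apply: cvgB; [apply: cvgD; [apply: cvgB|]|];
  repeat (apply: cvgM; first exact: cvg_cst); exact: cp.
Qed.

Lemma C1_fun_spline_primitive (V : normedModType R) (f : V -> R) :
  C1_fun f -> C1_fun (fun x => spline_primitive (f x)).
Proof.
move=> Cf; apply: (C1_fun_comp is_derive_spline_primitive) => //.
move=> u; apply: differentiable_continuous; apply/derivable1_diffP.
exact: (@ex_derive _ _ _ _ _ _ _ (is_derive_spline u)).
Qed.

Let splineE t : t <= -1 \/ -1 <= t <= - 3^-1 \/ - 3^-1 <= t <= 3^-1 \/
  3^-1 <= t <= 1 \/ 1 <= t.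
Proof.
have [?|?] := leP t (-1); first by left.
have [?|?] := leP t (- 3^-1); first by right; left; lra.
have [?|?] := leP t (3^-1); first by do 2 right; left; lra.
by have [?|?] := leP t 1; do 3 right; [left|right]; lra.
Qed.

Let pp0 t : t <= 0 -> pos_part t = 0.
Proof. by move=> t0; rewrite /pos_part maxEle t0. Qed.

Let ppE t : 0 <= t -> pos_part t = t.
Proof. by move=> t0; rewrite /pos_part maxEle; case: ifP => // t1; lra. Qed.

(** Left of the knots all truncated squares vanish; right of them the formula is the third
    difference of a quadratic polynomial, hence zero. *)
Lemma spline_eq0 t : 1 <= `|t| -> spline t = 0.
Proof.
rewrite ler_normr => /orP[] t1; rewrite /spline.
  by rewrite !ppE//; try lra; field.
by rewrite !pp0//; lra.
Qed.

Lemma spline_ge0 t : 0 <= spline t.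
Proof.
rewrite /spline; case: (splineE t) => [|[|[|[|]]]] h.
- by rewrite !pp0//; lra.
- by rewrite (ppE (t := 3 * t + 3)) ?pp0//; try lra; nra.
- by rewrite (ppE (t := 3 * t + 3)) ?(ppE (t := 3 * t + 1)) ?pp0//; try lra; nra.
- by rewrite (pp0 (t := 3 * t - 3)) ?ppE//; try lra; nra.
- by rewrite !ppE//; lra.
Qed.

Lemma spline_le1 t : spline t <= 1.
Proof.
rewrite /spline; case: (splineE t) => [|[|[|[|]]]] h.
- by rewrite !pp0//; lra.
- by rewrite (ppE (t := 3 * t + 3)) ?pp0//; try lra; nra.
- by rewrite (ppE (t := 3 * t + 3)) ?(ppE (t := 3 * t + 1)) ?pp0//; try lra; nra.
- by rewrite (pp0 (t := 3 * t - 3)) ?ppE//; try lra; nra.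
- by rewrite !ppE//; lra.
Qed.

Lemma spline_ge t : `|t| <= 2^-1 -> 4^-1 <= spline t.
Proof.
rewrite ler_norml /spline => /andP[t1 t2]; case: (splineE t) => [|[|[|[|]]]] h; [lra| | | |lra].
- by rewrite (ppE (t := 3 * t + 3)) ?pp0//; try lra; nra.
- by rewrite (ppE (t := 3 * t + 3)) ?(ppE (t := 3 * t + 1)) ?pp0//; try lra; nra.
- by rewrite (pp0 (t := 3 * t - 3)) ?ppE//; try lra; nra.
Qed.

Lemma spline_primitive_eq0 t : t <= -1 -> spline_primitive t = 0.
Proof. by move=> t1; rewrite /spline_primitive !pp0//; lra. Qed.

(** The third difference of the cube with step 2 is the constant 48, and 48/72 = 2/3. This value is
    the same for all rescaled copies, so their primitives agree far to the right. *)
Lemma spline_primitive_eq t : 1 <= t -> spline_primitive t = 2 / 3.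
Proof. by move=> t1; rewrite /spline_primitive !ppE//; try lra; field. Qed.

Lemma spline_primitive_itv t : 0 <= spline_primitive t <= 1.
Proof.
rewrite /spline_primitive; case: (splineE t) => [|[|[|[|]]]] h.
- by rewrite !pp0//; lra.
- rewrite (ppE (t := 3 * t + 3)) ?pp0//; try lra.
  have u0 : 0 <= 3 * t + 3 <= 2 by lra.
  by move: (3 * t + 3) u0 => u u0; apply/andP; split; nra.
- rewrite (ppE (t := 3 * t + 3)) ?(ppE (t := 3 * t + 1)) ?pp0//; try lra.
  have u0 : 0 <= 3 * t + 1 <= 2 by lra.
  rewrite (_ : 3 * t + 3 = (3 * t + 1) + 2); last by lra.
  by move: (3 * t + 1) u0 => u u0; apply/andP; split; nra.
- rewrite (pp0 (t := 3 * t - 3)) ?ppE//; try lra.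
  have u0 : 0 <= 3 - 3 * t <= 2 by lra.
  rewrite (_ : 3 * t + 3 = 6 - (3 - 3 * t)); last by lra.
  rewrite (_ : 3 * t + 1 = 4 - (3 - 3 * t)); last by lra.
  rewrite (_ : 3 * t - 1 = 2 - (3 - 3 * t)); last by lra.
  by move: (3 - 3 * t) u0 => u u0; apply/andP; split; nra.
- by rewrite !ppE//; lra.
Qed.

End quadratic_spline.

(** * Finite disjoint families and finite covers *)

Section disjoint_families.
Context {R : realType} {d : measure_display} {T : measurableType d} {I : eqType}.
Variables (m : {measure set T -> \bar R}) (r : rel I).
Implicit Types (s : seq I) (A : I -> set T).

(** Induction removes [A i] from [B], and the remaining sets still lie in the difference. The
    relation [r] on indices is kept apart from the sets, so that disjointness of cubes can later
    yield disjointness of other boxes indexed by them. *)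
Lemma pairwise_disjoint_sum_measure s A B :
  {in s &, forall i j, r i j -> A i `&` A j = set0} -> pairwise r s ->
  {in s, forall i, measurable (A i)} -> measurable B ->
  {in s, forall i, A i `<=` B} ->
  (\sum_(i <- s) m (A i) <= m B)%E.
Proof.
elim: s B => [|i s IH] B; first by rewrite big_nil measure_ge0.
move=> dA; rewrite pairwise_cons => /andP[/allP ri ps] mA mB AB.
have is_ : i \in i :: s by rewrite mem_head.
have ss j : j \in s -> j \in i :: s by rewrite inE orbC => ->.
have mAi := mA i is_.
rewrite big_cons (_ : B = A i `|` (B `\` A i)); last first.
  by rewrite setUDr setDv setD0 setUC; apply/esym/setUidPl; exact: AB.
rewrite measureU//; last 2 first.
  exact: measurableD.
  by rewrite setDE setICA setICr setI0.
rewrite leeD2l//; apply: IH => //.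
- by move=> j k js ks; apply: dA; exact: ss.
- by move=> j js; apply: mA; exact: ss.
- exact: measurableD.
- move=> j js x Ajx; split; first exact: (AB j (ss _ js)).
  move=> Aix; have := dA i j is_ (ss _ js) (ri _ js).
  by move/seteqP => [/(_ x)] /=; tauto.
Qed.

Lemma measure_le_sum_cover s A B :
  measurable B -> {in s, forall i, measurable (A i)} ->
  (forall x, B x -> exists2 i, i \in s & A i x) ->
  (m B <= \sum_(i <- s) m (A i))%E.
Proof.
elim: s B => [|i s IH] B mB mA BA.
  by rewrite (_ : B = set0) ?measure0 ?big_nil//; apply/seteqP; split => // x /BA[].
have mAi : measurable (A i) by apply: mA; rewrite mem_head.
rewrite big_cons; apply: (@le_trans _ _ (m (A i `|` (B `\` A i)))%E).
  apply: le_measure; rewrite ?inE//.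
    by apply: measurableU => //; exact: measurableD.
  by move=> x Bx; have [|] := pselect (A i x); [left|right].
apply: (le_trans (measureU2 _ _ _)) => //; first exact: measurableD.
rewrite leeD2l//; apply: IH.
- exact: measurableD.
- by move=> j js; apply: mA; rewrite inE js orbT.
- move=> x [Bx Aix]; have [j] := BA x Bx.
  by rewrite inE => /predU1P[->//|js Ajx]; exists j.
Qed.

End disjoint_families.

(** Pointwise form of disjoint supports: pointwise bounds on a sum of fields reduce to bounds on a
    single field. *)
Lemma pairwise_disjoint_sum (I : eqType) (V : nmodType) (r : rel I) (s : seq I)
    (F : I -> V) :
  {in s &, forall i j, r i j -> F i != 0 -> F j = 0} -> pairwise r s ->
  \sum_(i <- s) F i = 0 \/ exists2 i, i \in s & \sum_(i <- s) F i = F i.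
Proof.
elim: s => [|i s IH]; first by rewrite big_nil; left.
move=> dF; rewrite pairwise_cons big_cons => /andP[/allP ri ps].
have is_ : i \in i :: s by rewrite mem_head.
have ss j : j \in s -> j \in i :: s by rewrite inE orbC => ->.
have [Fi|Fi] := eqVneq (F i) 0.
  rewrite Fi add0r; case: IH => //.
  - by move=> j k js ks; apply: dF; exact: ss.
  - by left.
  - by move=> [j js ->]; right; exists j => //; exact: ss.
right; exists i => //; rewrite big_seq big1 ?addr0// => j js.
by apply: (dF i j) => //; [exact: ss|exact: ri].
Qed.

(** * Vitali covering for cubes *)

Section vitali.
Context {R : realType}.

Definition disjoint_balls (M : normedModType R) : rel (M * R) :=
  fun p q => `[< ball p.1 p.2 `&` ball q.1 q.2 = set0 >].

(** Greedy selection: keep a ball [p] of largest radius, discard those meeting it, and recurse. A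
    discarded ball has radius at most [p.2], hence lies in the triple of [p]. *)
Lemma vitali_finite (M : normedModType R) (s : seq (M * R)) :
  exists D : seq (M * R), [/\ {subset D <= s}, pairwise (@disjoint_balls M) D &
    {in s, forall p, exists2 q, q \in D & ball p.1 p.2 `<=` ball q.1 (3 * q.2)}].
Proof.
have [N] := ubnP (size s); elim: N s => // N IH s; rewrite ltnS => sN.
have [->|s0] := eqVneq s [::]; first by exists [::].
have [p ps pmax] : exists2 p, p \in s & {in s, forall q, q.2 <= p.2}.
  elim: {N IH sN} s s0 => // p s IHs _.
  have [->|/IHs[q qs qmax]] := eqVneq s [::].
    by exists p; rewrite ?mem_head// => q; rewrite inE => /eqP->.
  have [pq|qp] := leP p.2 q.2.
    exists q; first by rewrite inE qs orbT.
    by move=> u; rewrite inE => /predU1P[->//|]; exact: qmax.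
  exists p; first by rewrite mem_head.
  move=> u; rewrite inE => /predU1P[->//|/qmax uq].
  exact: le_trans uq (ltW qp).
pose s' := [seq q <- s | disjoint_balls p q].
(* If the largest radius is not positive, every ball of [s] is empty and one ball suffices.
   Otherwise [p] meets itself, so filtering shortens the list. *)
have [p0|p0] := leP p.2 0.
  exists [:: p]; split => //; first by move=> q; rewrite inE => /eqP ->.
  move=> q qs; exists p; first by rewrite mem_head.
  move=> y; rewrite -ball_normE /= => qy; have := normr_ge0 (q.1 - y).
  by have := pmax _ qs; lra.
have s'N : (size s' < N)%N.
  rewrite (leq_trans _ sN)// size_filter -(count_predC (disjoint_balls p)).
  rewrite -[X in (X < _)%N]addn0 ltn_add2l -has_count; apply/hasP; exists p => //=.
  apply/asboolPn; rewrite setIid => /seteqP[/(_ p.1) + _]; apply.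
  exact: ballxx.
have [D [Ds' pD cD]] := IH _ s'N.
exists (p :: D); split.
- move=> q; rewrite inE => /predU1P[->//|/Ds'].
  by rewrite mem_filter => /andP[].
- rewrite pairwise_cons pD andbT; apply/allP => q /Ds'.
  by rewrite mem_filter => /andP[].
- move=> q qs; have [pq|pq] := boolP (disjoint_balls p q).
    have [|u uD qu] := cD q; first by rewrite mem_filter pq.
    by exists u => //; rewrite inE uD orbT.
  exists p; first by rewrite mem_head.
  move: pq => /asboolPn/eqP/set0P[z [pz qz]] y qy.
  apply: (@le_ball _ _ _ (p.2 + (q.2 + q.2))).
    by have := pmax _ qs; lra.
  by apply: (ball_triangle pz); apply: ball_triangle qy; exact: ball_sym.
Qed.

Lemma rational_ball n (U : set 'rV[R]_n) x : open U -> U x ->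
  exists c : 'rV[rat]_n, exists e : rat,
    ball (map_mx ratr c : 'rV[R]_n) (ratr e) x /\
    ball (map_mx ratr c : 'rV[R]_n) (ratr e) `<=` U.
Proof.
move=> oU Ux.
have [e /= e0 eU] : nbhs_ball x U by apply/nbhs_ballP; exact: open_nbhs_nbhs.
have [q /itvP q0] : exists q : rat, ratr q \in `]0, (e / 2)[.
  by apply/rat_in_itvoo; rewrite divr_gt0.
have /choice[c cx] i : exists c : rat, ratr c \in `](x 0 i), (x 0 i + ratr q)[.
  by apply: rat_in_itvoo; rewrite ltrDl q0.
have xc : ball (map_mx ratr (\row_i c i) : 'rV[R]_n) (ratr q) x.
  split; first by rewrite q0.
  move=> j i; rewrite ord1 !mxE /ball/= ger0_norm ?subr_ge0 ?(itvP (cx i))//.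
  by rewrite ltrBlDl (itvP (cx i)).
exists (\row_i c i), q; split => // y cy; apply: eU.
apply: (@le_ball _ _ _ (ratr q + ratr q)).
  by have : ratr q < e / 2 by [rewrite q0]; lra.
by apply: ball_triangle cy; exact: ball_sym.
Qed.

(** Rational cubes contained in members of [V] form a countable cover of [U]. By continuity from
    below finitely many of them have measure above [t]; each is replaced by a member of [V]
    containing it, and [vitali_finite] applies. Working with a level [t] below [m U] includes the
    case [m U = +oo]. *)
Lemma vitali_measure n (m : {measure set 'rV[R]_n -> \bar R})
    (V : set ('rV[R]_n * R)) (U : set 'rV[R]_n) (t : \bar R) :
  measurable U ->
  (forall x, U x -> exists2 p, V p & ball p.1 p.2 x) ->
  (t < m U)%E ->
  exists D : seq ('rV[R]_n * R), [/\ forall p, p \in D -> V p,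
    pairwise (@disjoint_balls _) D &
    (t < \sum_(p <- D) m (ball p.1 (3 * p.2)))%E].
Proof.
move=> mU UV tU.
have mB (c : 'rV[R]_n) e : measurable (ball c e).
  by apply: open_measurable_rV; exact: ball_open.
pose B k : set 'rV[R]_n := if @unpickle ('rV[rat]_n * rat)%type k is Some q
  then ball (map_mx ratr q.1 : 'rV[R]_n) (ratr q.2) else set0.
have mBk k : measurable (B k).
  by rewrite /B; case: unpickle => // _; exact: measurable0.
pose good k := exists2 p, V p & B k `<=` ball p.1 p.2.
have /choice[c cP] k : exists p, good k -> V p /\ B k `<=` ball p.1 p.2.
  have [[p Vp Bp]|ng] := pselect (good k); first by exists p.
  (* A placeholder: only values of [c] at good indices are used. *)
  by exists (0, 0).
pose F N : set 'rV[R]_n := \bigcup_(k in [set k | (k < N)%N /\ good k]) B k.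
have mF N : measurable (F N) by exact: bigcup_measurable.
have UF : U `<=` \bigcup_N F N.
  move=> x Ux; have [p Vp px] := UV x Ux.
  have [q [e [qx qp]]] := rational_ball (@ball_open _ _ p.1 p.2) px.
  exists (pickle (q, e)).+1 => //; exists (pickle (q, e)); last first.
    by rewrite /B pickleK.
  by split => //; exists p => //; rewrite /B pickleK.
have mUF : measurable (\bigcup_N F N) by exact: bigcupT_measurable.
have ndF : nondecreasing_seq F.
  move=> i j ij; apply/subsetPset => x [k [ki gk] Bx]; exists k => //.
  by split => //; exact: leq_trans ij.
have tF : (t < m (\bigcup_N F N))%E.
  by apply: (lt_le_trans tU); apply: le_measure; rewrite ?inE.
have /cvg_lim mFE := @nondecreasing_cvg_mu _ _ _ m F mF mUF ndF.
have /cvg_lim supE : m \o F @ \oo --> ereal_sup (range (m \o F)).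
  apply: ereal_nondecreasing_cvgn => i j ij; apply: le_measure; rewrite ?inE//.
  by apply/subsetPset; exact: ndF.
move: tF; rewrite -mFE// supE// => /ereal_sup_gt[_ [N _ <-] /= tN].
pose s := [seq c k | k <- iota 0 N & `[< good k >]].
have [D [Ds pD cD]] := vitali_finite s.
exists D; split => //.
  move=> p /Ds /mapP[k]; rewrite mem_filter => /andP[/asboolP gk _] ->.
  by have [] := cP k gk.
apply: (lt_le_trans tN); apply: measure_le_sum_cover => //.
move=> x [k [kN gk] Bkx].
have [|q qD ckq] := cD (c k).
  apply: map_f; rewrite mem_filter mem_iota leq0n add0n kN !andbT. apply/asboolP; exact: gk.
exists q => //; apply: ckq.
by have [_] := cP k gk; exact.
Qed.

End vitali.

(** * Cubes, boxes and Euclidean balls *)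

Section cubes.
Context {R : realType} {n : nat}.
Local Notation leb := (lebesgue_measure_rV R n).
Implicit Types (x y a v : 'rV[R]_n) (r : R).

Lemma measurable_cube x r : measurable (ball x r).
Proof. by apply: open_measurable_rV; exact: ball_open. Qed.

Lemma cubeP x r y : 0 < r -> ball x r y <-> forall i, `|x 0 i - y 0 i| < r.
Proof.
move=> r0; split=> [[_ xy] i|xy]; first exact: xy.
by split => // j i; rewrite ord1; exact: xy.
Qed.

Lemma measurable_box (c e : 'I_n -> R) :
  measurable [set v : 'rV[R]_n | forall i, `|c i - v 0 i| < e i].
Proof.
rewrite (_ : [set _ | _] = \bigcap_(i in [set: 'I_n])
    ((fun v : 'rV[R]_n => v 0 i : measurableTypeR R) @^-1` ball (c i) (e i))); last first.
  by apply/seteqP; split => [x xc i _|x xc i]; exact: xc.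
apply: fin_bigcap_measurable => [|i _]; first exact: finite_finset.
rewrite -[X in measurable X]setTI.
exact: (@measurable_fun_coord R n i measurableT _ (measurable_realfun.measurable_ball _ _)).
Qed.

Lemma lebesgue_measure_box (c e : 'I_n -> R) : (forall i, 0 <= e i) ->
  leb [set v | forall i, `|c i - v 0 i| < e i] = (\prod_i (2 * e i))%:E.
Proof.
move=> e0; pose A i : set (measurableTypeR R) := ball (c i) (e i).
rewrite -[LHS]/(leb [set v : 'rV[R]_n | forall i, A i (v 0 i)]).
rewrite lebesgue_measure_rV_prod; last first.
  by move=> i; exact: measurable_realfun.measurable_ball.
rewrite -prodEFin; apply: eq_bigr => i _.
by rewrite lebesgue_measure_ball// mulr_natl.
Qed.

Lemma lebesgue_measure_cube x r : 0 < r -> leb (ball x r) = ((2 * r) ^+ n)%:E.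
Proof.
move=> r0; rewrite (_ : ball x r = [set v | forall i, `|x 0 i - v 0 i| < r]).
  by rewrite lebesgue_measure_box ?prodr_const ?card_ord// => _; exact: ltW.
by apply/seteqP; split => y /(cubeP _ _ r0).
Qed.

Lemma euclidean_norm_le v : euclidean_norm v <= \sum_(i < n) `|v 0 i|.
Proof.
rewrite /euclidean_norm -[leRHS]ger0_norm; last exact: sumr_ge0.
rewrite -sqrtr_sqr ler_wsqrtr// expr2 big_distrl/=.
apply: ler_sum => i _; rewrite -(real_normK (num_real (v 0 i))) expr2.
by rewrite ler_wpM2l// (bigD1 i)//= lerDl sumr_ge0.
Qed.

Lemma coord_le_euclidean_norm v i : `|v 0 i| <= euclidean_norm v :> R.
Proof.
rewrite /euclidean_norm -sqrtr_sqr ler_wsqrtr// (bigD1 i)//= lerDl.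
by apply: sumr_ge0 => j _; exact: sqr_ge0.
Qed.

(** The Euclidean norm is at most the sum of the [n] coordinates, each smaller than [r]; there must
    be at least one coordinate for the inequality to be strict. *)
Lemma cube_sub_euclidean_ball x r : (0 < n)%N ->
  ball x r `<=` euclidean_ball x (n%:R * r).
Proof.
move=> n0 y xy; have r0 : 0 < r by case: xy.
move: xy => /(cubeP _ _ r0) xy; rewrite /euclidean_ball/=.
apply: (le_lt_trans (euclidean_norm_le _)).
rewrite -[n in n%:R]card_ord mulr_natl -sumr_const.
apply: ltr_sum => [|i _]; last by rewrite !mxE distrC.
by apply/hasP; exists (Ordinal n0); rewrite ?mem_index_enum.
Qed.

Lemma euclidean_ball_sub_cube x r : 0 < r -> euclidean_ball x r `<=` ball x r.
Proof.
move=> r0 y; rewrite /euclidean_ball/= => xy; apply/(cubeP _ _ r0) => i.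
apply: le_lt_trans xy; rewrite distrC.
by have := coord_le_euclidean_norm (y - x) i; rewrite !mxE.
Qed.

Lemma C1_fun_coord i : C1_fun (fun v : 'rV[R]_n => v 0 i).
Proof.
split=> [x|v]; first exact: differentiable_coord.
rewrite (_ : 'D_v _ = cst (v 0 i)); first exact: cst_continuous.
apply/funext => x; have := @derive_mx R 'rV[R]_n 1 n id x v (@derivable_id _ _ _ _).
by rewrite derive_id => /matrixP/(_ 0 i) ->; rewrite mxE.
Qed.

Lemma measurable_euclidean_ball x r : 0 < r -> measurable (euclidean_ball x r).
Proof.
move=> r0; apply: open_measurable_rV.
pose S y : R := \sum_(i < n) (y 0 i - x 0 i) * (y 0 i - x 0 i).
have CS : C1_fun S.
  apply: C1_fun_sum => i; apply: C1_funM; apply: C1_funD;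
    by [exact: C1_fun_coord|exact: C1_fun_cst].
rewrite (_ : euclidean_ball _ _ = S @^-1` [set t | t < r ^+ 2]).
  by move/continuousP: (C1_fun_continuous CS); apply; exact: open_lt.
apply/seteqP; rewrite /euclidean_ball/euclidean_norm.
have SE y : \sum_(i < n) (y - x) 0 i ^+ 2 = S y.
  by apply: eq_bigr => i _; rewrite !mxE expr2.
have nE y : (Num.sqrt (S y) < r) = (S y < r ^+ 2).
  by rewrite -[in LHS](gtr0_norm r0) -sqrtr_sqr ltr_sqrt// exprn_gt0.
by split => y /=; rewrite SE nE.
Qed.

End cubes.

Import HBNNSimple.

(** * Lower bounds for [M1 mu] and decay of the density of [Omega] *)

Section M1_bounds.
Context {R : realType} {n : nat}.
Local Notation leb := (lebesgue_measure_rV R n).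
Local Open Scope ereal_scope.
Implicit Types (x y a v : 'rV[R]_n) (r : R).

(** In the quotient at radius [rho], the mass of the ball is bounded below by that of [A], and its
    volume above by that of the circumscribed cube. Taking [A] empty gives [0 <= M1 mu y]. *)
Lemma M1_ge (mu : {measure set 'rV[R]_n -> \bar R}) (A : set 'rV[R]_n) y (rho : R) :
  (0 < rho)%R -> measurable A -> A `<=` euclidean_ball y rho ->
  (rho / (2 * rho) ^+ n)%:E * mu A <= M1 mu y.
Proof.
move=> rho0 mA AE.
have mE := measurable_euclidean_ball y rho0.
apply: le_ereal_sup_tmp; exists (rho%:E * mu (euclidean_ball y rho) /
    leb (euclidean_ball y rho)); first by exists rho.
have rn0 : (0 < (2 * rho) ^+ n)%R by rewrite exprn_gt0// mulr_gt0.
have lE : leb (euclidean_ball y rho) <= ((2 * rho) ^+ n)%:E.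
  rewrite -(lebesgue_measure_cube y rho0).
  apply: le_measure; rewrite ?inE//; first exact: measurable_cube.
  exact: euclidean_ball_sub_cube.
have iE : ((2 * rho) ^+ n)^-1%:E <= (leb (euclidean_ball y rho))^-1.
  rewrite -[leLHS]/(((2 * rho) ^+ n)^-1%:E).
  have -> : ((2 * rho) ^+ n)^-1%:E = (((2 * rho) ^+ n)%:E)^-1 :> \bar R.
    by rewrite inver gt_eqF.
  by rewrite lee_pV2// inE ?measure_ge0// lee_fin ltW.
rewrite (_ : _ * mu A = rho%:E * mu A * ((2 * rho) ^+ n)^-1%:E); last first.
  by rewrite EFinM -!muleA (muleC (mu A)).
apply: lee_pmul => //.
- by rewrite mule_ge0// lee_fin ltW.
- by rewrite lee_fin invr_ge0 ltW.
- rewrite lee_pmul2l ?lte_fin//; apply: le_measure; rewrite ?inE//.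
Qed.

(** The integral of a nonnegative function is a supremum over simple functions below it, and
    [c * \1_A] is one of these. In this form it applies directly to [M1 mu]. *)
Lemma integral_ge_measure d (T : measurableType d) (m : {measure set T -> \bar R})
    (A : set T) (c : R) (f : T -> \bar R) :
  (0 <= c)%R -> measurable A -> (forall x : T, 0 <= f x) ->
  (forall x : T, A x -> c%:E <= f x) ->
  c%:E * m A <= \int[m]_x f x.
Proof.
move=> c0 mA f0 cf.
rewrite ge0_integralTE//; apply: le_ereal_sup_tmp.
pose h : {nnsfun T >-> R} := mul_nnsfun (cst_nnsfun T (NngNum c0)) (indic_nnsfun R mA).
exists (sintegral m h); last first.
  rewrite (_ : sintegral m h = c%:E * m A)//.
  by have := sintegralrM m c (indic_nnsfun R mA); rewrite sintegral_indic.
exists h => // x; rewrite -[h x]/(c * \1_A x)%R indicE.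
by case: (pselect (A x)) => Ax;
  [rewrite mem_set// mulr1 cf|rewrite memNset// mulr0].
Qed.

(** From each point of the cube of radius [r] about the origin, [M1 mu] sees the mass of the fixed
    cube of radius [R0], so it is at least of order [r ^+ n.-1] inverted there; integrating over
    [Omega] gives the bound. The quotient [r ^+ n / r] stands for the power [n - 1]. *)
Lemma volume_growth (mu : {measure set 'rV[R]_n -> \bar R}) (Omega : set 'rV[R]_n)
    (R0 : R) :
  (0 < n)%N -> (0 < R0)%R -> 0 < mu (ball (0%R : 'rV[R]_n) R0) -> measurable Omega ->
  \int[leb]_x (`|\1_Omega x|%:E * M1 mu x) < +oo ->
  exists C : R, (0 <= C)%R /\ forall r, (R0 <= r)%R ->
    leb (Omega `&` ball (0%R : 'rV[R]_n) r) <= (C * r ^+ n / r)%:E.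
Proof.
move=> n0 R00 mu0 mO Ifin.
have M10 x : 0 <= M1 mu x.
  have := @M1_ge mu set0 x 1%R ltr01 measurable0 (@sub0set _ _).
  by rewrite measure0 mule0.
(* The mass of the cube may be infinite here, so a positive real lower bound replaces it. *)
have [m0 m00 m0mu] : exists2 m0 : R, (0 < m0)%R & m0%:E <= mu (ball (0%R : 'rV[R]_n) R0).
  move: mu0; case: (mu _) => [q| |]//; first by rewrite lte_fin => q0; exists q.
  by move=> _; exists 1%R => //; rewrite leey.
set I := \int[leb]_x _ in Ifin.
have I0 : 0 <= I by apply: integral_ge0 => x _; rewrite mule_ge0// lee_fin.
have [A AE] : exists A : R, I = A%:E by exists (fine I); rewrite fineK// ge0_fin_numE.
have A0 : (0 <= A)%R by rewrite -lee_fin -AE.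
(* The Euclidean ball of radius [2 * n * r] about [x] contains the cube of radius [2 * r] about [x],
   hence the cube of radius [R0] about 0. *)
pose k : R := (2 * n%:R)%R.
have k0 : (0 < k)%R by rewrite mulr_gt0// ltr0n.
exists (A / m0 * ((2 * k) ^+ n / k))%R; split.
  have k2 : (0 <= (2 * k) ^+ n)%R by rewrite exprn_ge0// mulr_ge0// ltW.
  by apply: mulr_ge0; apply: divr_ge0 => //; exact: ltW.
move=> r R0r; have r0 : (0 < r)%R := lt_le_trans R00 R0r.
have kr0 : (0 < k * r)%R by rewrite mulr_gt0.
pose c := ((k * r) / (2 * (k * r)) ^+ n * m0)%R.
have c0 : (0 < c)%R.
  by rewrite mulr_gt0// divr_gt0// exprn_gt0// mulr_gt0.
have : c%:E * leb (Omega `&` ball (0%R : 'rV[R]_n) r) <= I.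
  apply: integral_ge_measure; first exact: ltW.
  - apply: measurableI => //; exact: measurable_cube.
  - by move=> x; rewrite mule_ge0// lee_fin.
  move=> x [Ox xr]; rewrite indicE mem_set// normr1 mul1e.
  apply: (@le_trans _ _ ((k * r / (2 * (k * r)) ^+ n)%:E * mu (ball (0%R : 'rV[R]_n) R0))).
    rewrite EFinM lee_wpmul2l// lee_fin; apply: divr_ge0; first exact: ltW.
    by rewrite exprn_ge0// mulr_ge0// ltW.
  apply: M1_ge => //; first exact: measurable_cube.
  move=> y yR0; rewrite (_ : k * r = n%:R * (r + r))%R; last by rewrite /k; ring.
  apply: cube_sub_euclidean_ball => //; apply: (ball_triangle (ball_sym xr)).
  exact: le_ball yR0.
rewrite -lee_pdivlMl// AE => /le_trans; apply.
rewrite -EFinM lee_fin /c.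
rewrite le_eqVlt; apply/orP; left; apply/eqP.
rewrite !exprMn; have kn0 : (k ^+ n != 0)%R by rewrite expf_neq0 ?gt_eqF.
have rn0 : (r ^+ n != 0)%R by rewrite expf_neq0 ?gt_eqF.
have pn0 : (2 ^+ n != 0 :> R)%R by rewrite expf_neq0.
by field; rewrite !gt_eqF ?exprn_gt0 ?ltr0n.
Qed.

Lemma density_le (mu : {measure set 'rV[R]_n -> \bar R}) (Omega : set 'rV[R]_n)
    (R0 : R) x (theta : R) :
  (0 < n)%N -> (0 < R0)%R -> 0 < mu (ball (0%R : 'rV[R]_n) R0) -> measurable Omega ->
  \int[leb]_x (`|\1_Omega x|%:E * M1 mu x) < +oo -> (0 < theta)%R ->
  exists K : R, forall r, (K <= r)%R ->
    leb (Omega `&` ball x r) <= (theta * r ^+ n)%:E.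
Proof.
move=> n0 R00 mu0 mO Ifin th0.
have [C [C0 CP]] := volume_growth n0 R00 mu0 mO Ifin.
have lb : (0 <= C * 2 ^+ n / theta)%R.
  by apply: divr_ge0; [rewrite mulr_ge0// exprn_ge0|exact: ltW].
(* The summands ensure in turn that [volume_growth] applies, that the cube about [x] lies in the one
   of radius [2 * r] about 0, and that [C * 2 ^+ n <= theta * r]. *)
exists (R0 + `|x| + C * 2 ^+ n / theta)%R => r Kr.
have x0 := normr_ge0 x.
have r0 : (0 < r)%R by lra.
apply: (@le_trans _ _ (leb (Omega `&` ball (0%R : 'rV[R]_n) (2 * r)%R))).
  apply: le_measure; rewrite ?inE.
  - by apply: measurableI => //; exact: measurable_cube.
  - by apply: measurableI => //; exact: measurable_cube.
  - move=> y [Oy xy]; split => //.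
    rewrite (_ : 2 * r = r + r)%R; last by ring.
    apply: ball_triangle xy; rewrite -ball_normE/= sub0r normrN; lra.
apply: (le_trans (CP _ _)); first by lra.
rewrite lee_fin ler_pdivrMr ?mulr_gt0// exprMn.
have rn0 : (0 <= r ^+ n)%R by rewrite exprn_ge0// ltW.
have : (C * 2 ^+ n <= theta * r)%R.
  by rewrite mulrC -ler_pdivrMl// mulrC; lra.
move: (2 ^+ n)%R (r ^+ n)%R rn0 lb => p q q0 _ Cp.
have := mulr_ge0 q0 (mulr_ge0 (ltW th0) (ltW r0)).
nra.
Qed.

End M1_bounds.

(** * Compactly supported vector fields and their divergence *)

Lemma continuous_sumr {R : realType} (V : normedModType R) (I : Type) (s : seq I)
    (F : I -> V -> R) :
  (forall i, continuous (F i)) -> continuous (fun x => \sum_(i <- s) F i x).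
Proof.
move=> cF; elim: s => [|i s IH] x.
  by under eq_fun do rewrite big_nil; exact: cvg_cst.
under eq_fun do rewrite big_cons.
by apply: cvgD; [exact: cF|exact: IH].
Qed.

Section vector_fields.
Context {R : realType} {n : nat}.
Local Notation leb := (lebesgue_measure_rV R n).
Implicit Types (phi : 'I_n -> 'rV[R]_n -> R) (x v : 'rV[R]_n).

Lemma differentiable_row m (phi' : 'I_m -> 'rV[R]_n -> R) x :
  (forall k, differentiable (phi' k) x) ->
  differentiable (fun y => \row_(k < m) phi' k y) x.
Proof.
move=> dphi.
rewrite (_ : (fun y => _) = \sum_k (fun y => phi' k y *: delta_mx 0 k)).
  by apply: differentiable_sum => k; exact: differentiableZl.
apply/funext => y; rewrite fct_sumE [LHS]row_sum_delta.
by apply: eq_bigr => k _; rewrite mxE.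
Qed.

Lemma derive_row m (phi' : 'I_m -> 'rV[R]_n -> R) x v :
  (forall k, differentiable (phi' k) x) ->
  'D_v (fun y => \row_(k < m) phi' k y) x = \row_k 'D_v (phi' k) x.
Proof.
move=> dphi; rewrite derive_mx.
  apply/rowP => k; rewrite !mxE; congr ('D_v _ x); apply/funext => y.
  by rewrite mxE.
by apply: diff_derivable; exact: differentiable_row.
Qed.

Lemma continuous_mx (T : topologicalType) p q (f : T -> 'M[R]_(p, q)) :
  (forall i j, continuous (fun t => f t i j)) -> continuous f.
Proof.
move=> cf t; apply/cvgrPdist_le => e e0; near=> s.
rewrite /Num.Def.normr/= mx_normrE (bigmax_le _ (ltW e0))//= => i _.
rewrite !mxE; move: i; near: s; apply: filter_forall => /= i.
exact: ((cvgrPdist_le _ _).1 (cf i.1 i.2 t)).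
Unshelve. all: by end_near. Qed.

Lemma closed_norm_le (M : R) : closed [set x : 'rV[R]_n | `|x| <= M].
Proof.
have := @closed_closed_ball_ R 'rV[R]_n 0 M; rewrite /closed_ball_.
by under eq_set do rewrite sub0r normrN.
Qed.

Lemma compact_norm_le (M : R) : compact [set x : 'rV[R]_n | `|x| <= M].
Proof.
apply: bounded_closed_compact; last exact: closed_norm_le.
exists M; split; first exact: num_real.
by move=> N MN x /= /le_trans; apply; exact: ltW.
Qed.

Lemma C1_compact_support_row phi (M : R) :
  (forall k, C1_fun (phi k)) -> (forall k x, phi k x != 0 -> `|x| <= M) ->
  C1_compact_support (fun x => \row_k phi k x).
Proof.
move=> Cphi sphi; split.
- by move=> x; apply: differentiable_row => k; case: (Cphi k).
- apply: continuous_mx => i j.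
  rewrite (_ : (fun _ => _) = 'D_(delta_mx 0 i) (phi j)); first by case: (Cphi j).
  apply/funext => x; rewrite /jacobian mxE -deriveE.
    by rewrite derive_row ?mxE// => k; case: (Cphi k).
  by apply: differentiable_row => k; case: (Cphi k).
- have sM : [set x | (\row_k phi k x : 'rV[R]_n) != 0] `<=` [set x | `|x| <= M].
    move=> x /= /eqP phix; apply: contrapT => xM; apply: phix.
    apply/rowP => k; rewrite !mxE; apply/eqP; apply: contrapT => /negP.
    by move/sphi.
  have cM := @closed_norm_le M.
  apply: bounded_closed_compact; last exact: closed_closure.
  exists M; split; first exact: num_real.
  move=> N MN x /(closure_subset sM); rewrite -(closure_id _).1// => /le_trans.
  by apply; exact: ltW.
Qed.

Lemma integrable_indic_lty d (T : measurableType d) (m : {measure set T -> \bar R})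
    (A : set T) :
  measurable A -> (m A < +oo)%E -> m.-integrable setT (fun x : T => (\1_A x)%:E).
Proof.
move=> mA Aoo; apply/integrableP; split; first exact/measurable_EFinP.
rewrite (eq_integral (fun x : T => (\1_A x)%:E)).
  by rewrite integral_indic// setIT.
by move=> t _; rewrite gee0_abs// lee_fin.
Qed.

(** A continuous function with bounded support is bounded, hence dominated by a multiple of the
    indicator of a cube. *)
Lemma integrable_indicM (f : 'rV[R]_n -> R) (Omega : set 'rV[R]_n) (M : R) :
  measurable Omega -> continuous f -> (forall x, f x != 0 -> `|x| <= M) ->
  leb.-integrable setT (fun x => (\1_Omega x * f x)%:E).
Proof.
move=> mO cf sf.
have cptM := @compact_norm_le M.
have : compact (f @` [set x | `|x| <= M]).
  by apply: continuous_compact => //; exact: continuous_subspaceT.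
move/compact_bounded => [B [_ /(_ (`|B| + 1))]].
rewrite (le_lt_trans (ler_norm _)) ?ltrDl// => /(_ isT) fB.
set B1 := `|B| + 1 in fB.
have B0 : 0 <= B1 by rewrite /B1 addr_ge0.
have M0 : 0 < `|M| + 1 by rewrite ltr_wpDl.
have mf : measurable_fun setT (f : 'rV[R]_n -> measurableTypeR R).
  apply: (measurability _ (measurable_realfun.RGenOpens.measurableE R)) => _ [_ [a [b ->]] <-].
  rewrite setTI; apply: open_measurable_rV.
  by move/continuousP: cf; apply; exact: interval_open.
apply: (@le_integrable _ _ _ _ _ measurableT _
    (fun x => B1%:E * (\1_(ball (0 : 'rV[R]_n) (`|M| + 1)) x)%:E)%E).
- apply/measurable_EFinP; apply: measurable_funM => //.
- move=> x _; rewrite -EFinM !abse_EFin lee_fin.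
  have [fx|fx] := eqVneq (f x) 0; first by rewrite fx mulr0 normr0.
  have xM := sf x fx.
  rewrite [in leRHS]indicE mem_set ?mulr1; last first.
    rewrite -ball_normE/= sub0r normrN (le_lt_trans xM)//.
    by rewrite (le_lt_trans (ler_norm _))// ltrDl.
  rewrite (ger0_norm B0) normrM -[leRHS]mul1r ler_pM//.
    by rewrite indicE; case: (_ \in _); rewrite ?normr1 ?normr0.
  by apply: fB; exists x.
- apply: integrableZl => //; apply: integrable_indic_lty.
    exact: measurable_cube.
  apply: (@le_lt_trans _ _ ((2 * (`|M| + 1)) ^+ n)%:E); last exact: ltry.
  by rewrite -(lebesgue_measure_cube 0 M0).
Qed.

(** Fields are handled as families of scalar components; [divergence_row] passes to the row
    vector. *)
Definition div phi x : R := \sum_k 'D_(delta_mx 0 k) (phi k) x.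

Lemma divergence_row phi :
  divergence (fun x => \row_k phi k x) = div phi.
Proof.
apply/funext => x; apply: eq_bigr => k _; congr ('D_(_) _ x).
by apply/funext => y; rewrite mxE.
Qed.

Lemma derive_eq0 (f : 'rV[R]_n -> R) v x :
  (forall h : R, f (h *: v + x) = f x) -> 'D_v f x = 0.
Proof.
move=> fE; rewrite /derive; apply/cvg_lim => //.
rewrite (_ : (fun _ => _) = fun=> 0); first exact: cvg_cst.
by apply/funext => h /=; rewrite fE subrr scaler0.
Qed.

Lemma integrable_div phi (Omega : set 'rV[R]_n) (M : R) :
  measurable Omega -> (forall k, C1_fun (phi k)) ->
  (forall k x, phi k x != 0 -> `|x| <= M) ->
  leb.-integrable setT (fun x => (\1_Omega x * div phi x)%:E).
Proof.
move=> mO Cphi sphi; apply: (@integrable_indicM _ _ M) => //.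
  by apply: continuous_sumr => k; exact: (Cphi k).2.
move=> x; apply: contraNT; rewrite -ltNge => Mx.
rewrite /div big1// => k _.
(* The component vanishes on a whole neighbourhood of [x], since the norm stays above [M] there. *)
rewrite (_ : 'D_ _ _ x = 'D_(delta_mx 0 k) (cst (0 : R)) x); first exact: derive_cst.
apply: near_eq_derive; near=> y.
apply/eqP; apply: contrapT => /negP/sphi; apply/negP; rewrite -ltNge.
near: y; apply: (cvgr_gt (`|x|)) => //; exact: norm_continuous.
Unshelve. all: by end_near. Qed.

Lemma div_sum (I : Type) (s : seq I) (c : I -> R) (phi : I -> 'I_n -> 'rV[R]_n -> R) x :
  (forall i k, C1_fun (phi i k)) ->
  div (fun k x => \sum_(i <- s) c i * phi i k x) x =
  \sum_(i <- s) c i * div (phi i) x.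
Proof.
move=> Cphi; elim: s => [|i s IH].
  rewrite big_nil /div big1// => k _; under eq_fun do rewrite big_nil.
  exact: derive_cst.
rewrite big_cons -IH /div mulr_sumr -big_split/=; apply: eq_bigr => k _.
under eq_fun do rewrite big_cons.
have [d1 _] := Cphi i k.
have [d2 _] : C1_fun (fun y => \sum_(j <- s) c j * phi j k y).
  by apply: C1_fun_sum => j; apply: C1_funM => //; exact: C1_fun_cst.
rewrite [LHS]deriveD; [|apply: diff_derivable..] => //; last first.
  by apply: differentiableM => //; exact: differentiable_cst.
congr (_ + _); rewrite -[RHS]deriveMl//; exact: diff_derivable.
Qed.

End vector_fields.

(** * Telescoping of products, one factor at a time *)

Section hybrid_product.
Context {R : realType} {n : nat}.
Implicit Types (al be : 'I_n -> R).

(** Let [P k] be the product with its first [k] factors taken from [al] and the rest from [be]. Then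
    the [k]-th summand is [P k - P k.+1]. *)
Lemma telescope_hybrid_prod al be :
  \sum_k (be k - al k) * \prod_(i | i != k) (if (i < k)%N then al i else be i) =
  \prod_i be i - \prod_i al i.
Proof.
pose P (k : nat) := \prod_(i < n) (if (i < k)%N then al i else be i).
rewrite (_ : \prod_i be i = P 0%N)//.
rewrite (_ : \prod_i al i = P n); last first.
  by apply: eq_bigr => i _; rewrite ltn_ord.
rewrite -opprB -(telescope_sumr P (leq0n n)) big_mkord -sumrN.
apply: eq_bigr => k _; rewrite opprB /P.
rewrite [X in _ = X - _](bigD1 k)//= [X in _ = _ - X](bigD1 k)//= ltnn ltnSn.
rewrite mulrBl; congr (_ - _ * _).
apply: eq_bigr => i ik; rewrite [in RHS]ltnS [in RHS]leq_eqVlt.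
by rewrite (negbTE (ik : (i : nat) != k)).
Qed.

End hybrid_product.

(** * The field transporting one bump to another *)

Section cell.
Context {R : realType} {n : nat}.
Local Notation leb := (lebesgue_measure_rV R n).
Implicit Types (x y : 'rV[R]_n) (p q : 'rV[R]_n * R) (k : 'I_n).

(** A cube is a pair of centre and half-side; this affine chart maps it to the cube with coordinates
    between -1 and 1. *)
Let coord p i x : R := (x 0 i - p.1 0 i) / p.2.

Let C1_coord p i : C1_fun (coord p i).
Proof.
by apply: C1_funM; [apply: C1_funD; [exact: C1_fun_coord|]|]; exact: C1_fun_cst.
Qed.

Definition cube_bump p x : R := \prod_i spline (coord p i x).

Lemma cube_bump_ge0 p x : 0 <= cube_bump p x.
Proof. by apply: prodr_ge0 => i _; exact: spline_ge0. Qed.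

Lemma cube_bump_le1 p x : cube_bump p x <= 1.
Proof. by apply: prodr_ile1 => i _; rewrite spline_ge0 spline_le1. Qed.

Let coord_lt1 p i x : 0 < p.2 -> (`|coord p i x| < 1) = (`|p.1 0 i - x 0 i| < p.2).
Proof.
by move=> p0; rewrite normrM normfV (gtr0_norm p0) distrC ltr_pdivrMr ?mul1r.
Qed.

Lemma cube_bump_neq0 p x : 0 < p.2 -> cube_bump p x != 0 -> ball p.1 p.2 x.
Proof.
move=> p0 /prodf_neq0 px; apply/(cubeP _ _ p0) => i.
rewrite -coord_lt1// ltNge; apply: contraNN (px i isT) => c1.
by rewrite spline_eq0.
Qed.

Lemma cube_bump_ge p x : 0 < p.2 -> ball p.1 (p.2 / 2) x ->
  4^-1 ^+ n <= cube_bump p x.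
Proof.
move=> p0 /cubeP px; rewrite -[n in _ ^+ n]card_ord -prodr_const.
apply: ler_prod => i _; rewrite invr_ge0 ler0n/=; apply: spline_ge.
rewrite normrM normfV (gtr0_norm p0) distrC ler_pdivrMr// mulrC ltW//.
by apply: px; rewrite divr_gt0.
Qed.

(* Transports the bump of the cube [p] into the (rescaled) bump of the cube
   [p0], one coordinate at a time: the coordinates below [k] have already been
   moved, and coordinate [k] is integrated from -oo. *)
Definition transport p0 p k x : R :=
  p.2 * (spline_primitive (coord p k x) - spline_primitive (coord p0 k x)) *
  \prod_(i | i != k) (if (i < k)%N then p.2 / p0.2 * spline (coord p0 i x)
                      else spline (coord p i x)).

Lemma C1_fun_transport p0 p k : C1_fun (transport p0 p k).
Proof.
apply: C1_funM.
  apply: C1_funM; first exact: C1_fun_cst.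
  by apply: C1_funB; exact: C1_fun_spline_primitive.
apply: C1_fun_prod => i; case: (i < k)%N; last exact: C1_fun_spline.
by apply: C1_funM; [exact: C1_fun_cst|exact: C1_fun_spline].
Qed.

Let derive_spline_primitive p k x :
  'D_(delta_mx 0 k) (fun x => spline_primitive (coord p k x)) x = spline (coord p k x) / p.2.
Proof.
have [dc _] := C1_coord p k.
rewrite (derive_scalar_comp _ (is_derive_spline_primitive _) (dc x)) mulrC.
congr (_ * _).
have dk : derivable (fun x : 'rV[R]_n => x 0 k) x (delta_mx 0 k).
  by apply: diff_derivable; exact: differentiable_coord.
rewrite (_ : coord p k = p.2^-1 \o* ((fun x => x 0 k) + cst (- p.1 0 k)))//.
have dc' : derivable (cst (- p.1 0 k) : 'rV[R]_n -> R) x (delta_mx 0 k).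
  exact: derivable_cst.
rewrite deriveMr; last exact: derivableD.
rewrite deriveD// derive_cst addr0.
have /matrixP/(_ 0 k) := @derive_mx R 'rV[R]_n 1 n id x (delta_mx 0 k) (@derivable_id _ _ _ _).
by rewrite derive_id !mxE !eqxx => <-; rewrite mulr1.
Qed.

(** Only the difference of primitives depends on coordinate [k]. The prefactor [p.2] cancels the
    inner derivative of the first and leaves the ratio [p.2 / p0.2] on the second. *)
Lemma derive_transport p0 p k x : p.2 != 0 ->
  'D_(delta_mx 0 k) (transport p0 p k) x =
  (spline (coord p k x) - p.2 / p0.2 * spline (coord p0 k x)) *
  \prod_(i | i != k) (if (i < k)%N then p.2 / p0.2 * spline (coord p0 i x)
                      else spline (coord p i x)).
Proof.
move=> p20.
pose f y := p.2 * (spline_primitive (coord p k y) - spline_primitive (coord p0 k y)).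
pose g y := \prod_(i | i != k) (if (i < k)%N
  then p.2 / p0.2 * spline (coord p0 i y) else spline (coord p i y)).
have dB q : derivable (fun x => spline_primitive (coord q k x)) x (delta_mx 0 k).
  by apply: diff_derivable; case: (C1_fun_spline_primitive (C1_coord q k)).
have Cg : C1_fun g.
  apply: C1_fun_prod => i; case: (i < k)%N; last exact: C1_fun_spline.
  by apply: C1_funM; [exact: C1_fun_cst|exact: C1_fun_spline].
have df : derivable f x (delta_mx 0 k).
  by apply: derivableM; [exact: derivable_cst|exact: derivableB].
rewrite [LHS](@deriveM _ _ f g)//; last by apply: diff_derivable; case: Cg.
have -> : 'D_(delta_mx 0 k) g x = 0.
  apply: derive_eq0 => h; apply: eq_bigr => i ik.
  by rewrite /coord !mxE eqxx (negbTE ik) mulr0 add0r.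
rewrite scaler0 add0r /GRing.scale/= mulrC; congr (_ * _).
rewrite [LHS]deriveMl; last exact: derivableB.
rewrite deriveB// !derive_spline_primitive mulrBr.
by congr (_ - _); [rewrite mulrC divfK|ring].
Qed.

(** The partial derivatives are the summands of [telescope_hybrid_prod], with the rescaled splines
    of [p0] as [al] and those of [p] as [be]. *)
Lemma div_transport p0 p x : p.2 != 0 ->
  div (transport p0 p) x = cube_bump p x - (p.2 / p0.2) ^+ n * cube_bump p0 x.
Proof.
move=> p20; rewrite /div.
under eq_bigr do rewrite derive_transport//.
rewrite (telescope_hybrid_prod (fun i => p.2 / p0.2 * spline (coord p0 i x))
  (fun i => spline (coord p i x))).
by rewrite [X in _ - X]big_split/= prodr_const card_ord.
Qed.

End cell.

(** * Superposition of transports inside one cube *)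

Section cell_field.
Context {R : realType} {n : nat}.
Local Notation leb := (lebesgue_measure_rV R n).
Variables (Omega : set 'rV[R]_n) (a : 'rV[R]_n) (r : R).
Hypothesis r0 : 0 < r.
Implicit Types (x y : 'rV[R]_n) (p q : 'rV[R]_n * R) (k : 'I_n) (F : seq ('rV[R]_n * R)).

Let inner p := [/\ 0 < p.2, forall i, `|a 0 i - p.1 0 i| + p.2 <= r &
  ball p.1 p.2 `<=` Omega].

Let inner_coord p i (t : R) : inner p -> `|p.1 0 i - t| < p.2 -> `|a 0 i - t| < r.
Proof.
move=> [_ /(_ i) ap _] pt; apply: lt_le_trans ap.
by rewrite -(subrKA (p.1 0 i)) (le_lt_trans (ler_normD _ _))// ltrD2l.
Qed.

(** Outside the big cube in a coordinate other than [k], a spline factor vanishes. In coordinate [k]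
    both primitives have the same value, 0 on the left and 2/3 on the right, so their difference
    vanishes. *)
Lemma transport_support p k x : inner p -> transport (a, r) p k x != 0 -> ball a r x.
Proof.
move=> ip; have [p0 ap _] := ip.
rewrite /transport !mulf_eq0 !negb_or => /andP[/andP[_ Bk] /prodf_neq0 pi].
apply/(cubeP _ _ r0) => i; rewrite ltNge; apply/negP => xi.
have farB : r <= x 0 i - a 0 i \/ r <= a 0 i - x 0 i.
  by move: xi; rewrite ler_normr => /orP[|]; [right|left; rewrite -opprB].
have [ik|ik] := eqVneq i k; last first.
  have := pi i ik; case: ifP => _; apply/negP/negPn.
    rewrite spline_eq0 ?mulr0// normrM normfV (gtr0_norm r0) distrC.
    by rewrite ler_pdivlMr ?mul1r.
  apply/eqP/spline_eq0; rewrite normrM normfV (gtr0_norm p0) distrC.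
  rewrite ler_pdivlMr// mul1r leNgt; apply/negP => /(inner_coord ip).
  by rewrite ltNge xi.
move: Bk; rewrite -ik; apply/negP/negPn; rewrite subr_eq0; apply/eqP.
have api := ap i; have := ler_norm (a 0 i - p.1 0 i).
have := ler_norm (p.1 0 i - a 0 i); rewrite (distrC (p.1 0 i)) => n1 n2.
case: farB => h.
  by rewrite !spline_primitive_eq// ler_pdivlMr// mul1r/=; lra.
by rewrite !spline_primitive_eq0// ler_pdivrMr// mulN1r/=; lra.
Qed.

Let meets k x p := [forall (i : 'I_n | (k < i)%N), `|p.1 0 i - x 0 i| < p.2].

(** The fraction of the big cube filled by a box with the first [k.+1] sides of [p] and the
    remaining sides of the big cube. *)
Let ratio k p := \prod_(i < n) (if (i <= k)%N then p.2 / r else 1).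

(** Each coordinate after [k] contributes a spline of [p], zero unless the slice through [x] meets
    [p]. Each one before [k] contributes at most [p.2 / r], and the prefactor [p.2] is [r] times the
    ratio of coordinate [k]. *)
Lemma transport_bound p k x : 0 < p.2 ->
  `|transport (a, r) p k x| <= if meets k x p then r * ratio k p else 0.
Proof.
move=> p0; case: ifPn => [_|/forallPn[i]]; last first.
  rewrite negb_imply => /andP[ki]; rewrite -leNgt => xi.
  rewrite normr_le0 /transport mulf_eq0; apply/orP; right.
  apply/prodf_eq0; exists i; first by rewrite neq_ltn ki orbT.
  rewrite ltnNge (ltnW ki)/=; apply/eqP/spline_eq0.
  by rewrite normrM normfV (gtr0_norm p0) distrC ler_pdivlMr// mul1r.
rewrite (_ : r * ratio k p = p.2 * 1 *
    \prod_(i | i != k) (if (i < k)%N then p.2 / r else 1)); last first.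
  rewrite /ratio (bigD1 k)//= leqnn mulrA mulr1 [r * _]mulrC divfK ?gt_eqF//.
  congr (_ * _); apply: eq_bigr => i ik.
  by rewrite leq_eqVlt (negbTE (ik : (i : nat) != k)).
rewrite /transport !normrM (gtr0_norm p0) normr_prod.
apply: ler_pM => //; first by rewrite mulr_ge0// ltW.
  by apply: prodr_ge0.
  rewrite ler_wpM2l//; first exact: ltW.
  have /andP[h1 h2] := spline_primitive_itv ((x 0 k - p.1 0 k) / p.2).
  have /andP[h3 h4] := spline_primitive_itv ((x 0 k - a 0 k) / r).
  by rewrite ler_norml; apply/andP; split; lra.
apply: ler_prod => i _; rewrite normr_ge0/=; case: ifP => _; last first.
  by rewrite ger0_norm ?spline_ge0 ?spline_le1.
have pr0 : 0 <= p.2 / r by rewrite divr_ge0// ltW.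
rewrite normrM (ger0_norm pr0) ger0_norm ?spline_ge0//.
by rewrite -[leRHS]mulr1 ler_wpM2l// spline_le1.
Qed.

(* The boxes [p x (a - r, a + r)] (product of the first [k.+1] sides of the
   cube [p] and of the last sides of the big cube) are disjoint when the cubes
   [p] all meet the slice through [x]. *)
Lemma sum_ratio_le1 F k x : (forall p, p \in F -> inner p) ->
  pairwise (@disjoint_balls _ _) F ->
  \sum_(p <- F | meets k x p) ratio k p <= 1.
Proof.
move=> iF dF; pose c p (i : 'I_n) := if (i <= k)%N then p.1 0 i else a 0 i.
pose e p (i : 'I_n) := if (i <= k)%N then p.2 else r.
pose A p := [set y : 'rV[R]_n | forall i : 'I_n, `|c p i - y 0 i| < e p i].
have rn0 : 0 < (2 * r) ^+ n by rewrite exprn_gt0// mulr_gt0.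
have iF' p : p \in [seq p <- F | meets k x p] -> inner p /\ meets k x p.
  by rewrite mem_filter => /andP[mp /iF].
have : (\sum_(p <- [seq p <- F | meets k x p]) leb (A p) <= leb (ball a r))%E.
  apply: (@pairwise_disjoint_sum_measure _ _ _ _ _ (@disjoint_balls _ _)).
  - move=> p q pF qF /asboolP pq; apply/seteqP; split => // y [Ap Aq].
    have [[p0 _ _] /forallP mp] := iF' _ pF; have [[q0 _ _] /forallP mq] := iF' _ qF.
    (* A common point [y] of two boxes, with its last coordinates replaced by those of [x], is a
       common point of the two cubes. *)
    have zz : (ball p.1 p.2 `&` ball q.1 q.2)
        (\row_(i < n) if (i <= k)%N then y 0 i else x 0 i).
      split; apply/cubeP => // i; rewrite mxE; case: ifPn => ik.
      + by have := Ap i; rewrite /c /e ik.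
      + by have /implyP := mp i; apply; rewrite ltnNge.
      + by have := Aq i; rewrite /c /e ik.
      + by have /implyP := mq i; apply; rewrite ltnNge.
    by rewrite pq in zz.
  - exact: pairwise_filter.
  - by move=> p _; exact: measurable_box.
  - exact: measurable_cube.
  - move=> p /iF'[ip _] y Ay; apply/(cubeP _ _ r0) => i.
    have := Ay i; rewrite /c /e; case: ifP => // _; exact: inner_coord.
rewrite lebesgue_measure_cube// (eq_big_seq (fun p => (\prod_i (2 * e p i))%:E)).
  rewrite sumEFin lee_fin big_filter => le1.
  rewrite -(ler_pM2r rn0) mul1r mulr_suml (le_trans _ le1)//.
  apply: ler_sum => p _; rewrite -[n in _ ^+ n]card_ord -prodr_const -big_split/=.
  rewrite le_eqVlt; apply/orP; left; apply/eqP/eq_bigr => i _.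
  by rewrite /e; case: ifP => _; rewrite ?mul1r// mulrCA divfK// gt_eqF.
move=> p /iF'[[p0 _ _] _]; apply: lebesgue_measure_box => i.
by rewrite /e; case: ifP => _; exact: ltW.
Qed.

Lemma transport_sum_bound F k x : (forall p, p \in F -> inner p) ->
  pairwise (@disjoint_balls _ _) F ->
  `|\sum_(p <- F) transport (a, r) p k x| <= r.
Proof.
move=> iF dF; apply: (le_trans (ler_norm_sum _ _ _)).
apply: (@le_trans _ _ (\sum_(p <- F) (if meets k x p then r * ratio k p else 0))).
  by rewrite big_seq [leRHS]big_seq; apply: ler_sum => p /iF[p0 _ _]; exact: transport_bound.
rewrite -big_mkcond -mulr_sumr -[leRHS]mulr1 ler_wpM2l//; first exact: ltW.
exact: sum_ratio_le1.
Qed.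

Lemma lebesgue_measure_cube_lty x s : (leb (ball x s) < +oo)%E.
Proof.
have [s0|s0] := ltP 0 s; first by rewrite lebesgue_measure_cube// ltry.
rewrite (_ : ball x s = set0) ?measure0 ?ltry//.
by apply/seteqP; split => // y [+ _]; rewrite ltNge s0.
Qed.

(** Each [p] gains at least [4^-1 ^+ n] on its half cube, of volume [p.2 ^+ n] and contained in
    [Omega]. It loses at most [(p.2 / r) ^+ n] on the part of [Omega] in the big cube, and [small]
    makes this loss at most half of the gain. *)
Lemma integral_div_transport F : open Omega -> (forall p, p \in F -> inner p) ->
  (leb (Omega `&` ball a r) <= (4^-1 ^+ n / 2 * r ^+ n)%:E)%E ->
  ((4^-1 ^+ n / 2 * \sum_(p <- F) p.2 ^+ n)%:E <=
   \int[leb]_x (\1_Omega x * div (fun k x => \sum_(p <- F) transport (a, r) p k x) x)%:E)%E.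
Proof.
move=> oO iF small.
have mO : measurable Omega := open_measurable_rV oO.
pose U := Omega `&` ball a r.
have mU : measurable U by apply: measurableI => //; exact: measurable_cube.
have Uoo : (leb U < +oo)%E by exact: le_lt_trans small (ltry _).
have [u uE] : exists u : R, leb U = u%:E.
  by exists (fine (leb U)); rewrite fineK// ge0_fin_numE.
have uth : u <= 4^-1 ^+ n / 2 * r ^+ n by rewrite -lee_fin -uE.
pose g p x : R := 4^-1 ^+ n * \1_(ball p.1 (p.2 / 2)) x - (p.2 / r) ^+ n * \1_U x.
have i1 p : leb.-integrable setT (fun x => (\1_(ball p.1 (p.2 / 2)) x)%:E).
  apply: integrable_indic_lty; first exact: measurable_cube.
  exact: lebesgue_measure_cube_lty.
have i2 : leb.-integrable setT (fun x => (\1_U x)%:E) by exact: integrable_indic_lty.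
have ig p : leb.-integrable setT (fun x => (g p x)%:E).
  rewrite (_ : (fun x => _) = (fun x => (4^-1 ^+ n)%:E * (\1_(ball p.1 (p.2 / 2)) x)%:E)%E
    \- (fun x => ((p.2 / r) ^+ n)%:E * (\1_U x)%:E))%E.
    by apply: integrableB => //; exact: integrableZl.
  by apply/funext => x; rewrite /g EFinB 2!EFinM.
have intg p : p \in F -> ((4^-1 ^+ n / 2 * p.2 ^+ n)%:E <= \int[leb]_x (g p x)%:E)%E.
  move=> pF; have [p0 _ _] := iF p pF.
  have -> : (\int[leb]_x (g p x)%:E = (4^-1 ^+ n * p.2 ^+ n - (p.2 / r) ^+ n * u)%:E)%E.
    under eq_integral do rewrite EFinB 2!EFinM.
    rewrite integralB//; [|exact: integrableZl..].
    rewrite !integralZl// !integral_indic//; last exact: measurable_cube.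
    rewrite !setIT [X in (_ - _ * X)%E]uE.
    rewrite [X in (_ * X - _)%E](lebesgue_measure_cube p.1 (divr_gt0 p0 (ltr0n R 2))).
    by rewrite [2 * _]mulrC divfK.
  rewrite lee_fin; have : (p.2 / r) ^+ n * u <= 4^-1 ^+ n / 2 * p.2 ^+ n.
    rewrite (_ : _ * p.2 ^+ n = (p.2 / r) ^+ n * (4^-1 ^+ n / 2 * r ^+ n)).
      by apply: ler_wpM2l => //; rewrite exprn_ge0// divr_ge0// ltW.
    by rewrite expr_div_n mulrCA divfK// expf_neq0// gt_eqF.
  by move: (4^-1 ^+ n) => th; lra.
rewrite mulr_sumr.
apply: (@le_trans _ _ (\int[leb]_x (\sum_(p <- F) (g p x)%:E))%E).
  rewrite integral_sum// -sumEFin big_seq [leRHS]big_seq.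
  by apply: lee_sum => p pF; exact: intg.
pose phi p := transport (a, r) p.
have Cphi p k : C1_fun (phi p k) by exact: C1_fun_transport.
apply: le_integral => //.
- exact: integrable_sum.
- apply: (@integrable_div _ _ _ _ (`|a| + r)) => //.
    by move=> k; apply: C1_fun_sum => p; exact: Cphi.
  move=> k x sx; have [p pF px] : exists2 p, p \in F & phi p k x != 0.
    apply: contrapT => np; move: sx; rewrite big_seq big1 ?eqxx// => p pF.
    by apply/eqP; apply: contrapT => /negP px; apply: np; exists p.
  have := transport_support (iF p pF) px; rewrite -ball_normE/= => axr.
  rewrite -(subrKC a x) (le_trans (ler_normD _ _))// lerD2l distrC ltW//.
move=> x _; rewrite sumEFin lee_fin.
rewrite (_ : (fun k x => _) = (fun k x => \sum_(p <- F) 1 * phi p k x)); last first.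
  by apply/funext => k; apply/funext => y; apply: eq_bigr => p _; rewrite mul1r.
rewrite div_sum// mulr_sumr big_seq [leRHS]big_seq; apply: ler_sum => p pF.
have [p0 _ pO] := iF p pF.
rewrite mul1r div_transport ?gt_eqF// mulrBr lerB//.
  rewrite [X in _ * X <= _]indicE; case: (boolP (x \in _)) => [|_].
    move=> /set_mem px; rewrite indicE mem_set ?mulr1 ?mul1r; first exact: cube_bump_ge.
    by apply: pO; apply: le_ball px; rewrite ler_pdivrMr// ler_pMr// ler1n.
  by rewrite mulr0 mulr_ge0// cube_bump_ge0.
rewrite mulrCA; apply: ler_wpM2l; first by rewrite exprn_ge0// divr_ge0// ltW.
rewrite 2!indicE.
have [->|/(cube_bump_neq0 (p := (a, r)) r0) ax] := eqVneq (cube_bump (a, r) x) 0.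
  by rewrite mulr0.
rewrite in_setI [X in _ && X]mem_set// andbT.
by rewrite -[leRHS]mulr1 ler_wpM2l// cube_bump_le1.
Qed.

End cell_field.

(** * Relative isoperimetric inequality by duality *)

Section cell_existence.
Context {R : realType} {n : nat}.
Local Notation leb := (lebesgue_measure_rV R n).

Lemma relative_isoperimetry (Omega : set 'rV[R]_n) (a : 'rV[R]_n) (r : R) :
  0 < r -> open Omega ->
  (leb (Omega `&` ball a r) <= (4^-1 ^+ n / 2 * r ^+ n)%:E)%E ->
  exists phi : 'I_n -> 'rV[R]_n -> R, [/\ forall k, C1_fun (phi k),
    forall k x, phi k x != 0 -> ball a r x,
    forall x, (euclidean_norm (\row_k phi k x) <= n%:R * r)%R &
    ((4^-1 ^+ n / 4 / 6 ^+ n)%:E * leb (Omega `&` ball a r) <=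
      \int[leb]_x (\1_Omega x * div phi x)%:E)%E].
Proof.
move=> r0 oO small.
pose inner (p : 'rV[R]_n * R) := [/\ 0 < p.2, forall i, `|a 0 i - p.1 0 i| + p.2 <= r &
  ball p.1 p.2 `<=` Omega].
pose U := Omega `&` ball a r.
have oU : open U by apply: openI => //; exact: ball_open.
have mU : measurable U := open_measurable_rV oU.
have [u uE] : exists u : R, leb U = u%:E.
  exists (fine (leb U)); rewrite fineK// ge0_fin_numE//.
  exact: le_lt_trans small (ltry _).
have u0 : 0 <= u by rewrite -lee_fin -uE.
have coverU x : U x -> exists2 p, inner p & ball p.1 p.2 x.
  move=> Ux; have [e /= e0 eU] : nbhs_ball x U.
    by apply/nbhs_ballP; exact: open_nbhs_nbhs.
  have [_ axr] := Ux; have {}axr : `|a - x| < r by move: axr; rewrite -ball_normE.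
  (* Small enough to stay inside [Omega] and inside the big cube. *)
  pose s := Num.min e (r - `|a - x|).
  have s0 : 0 < s by rewrite lt_min e0 subr_gt0.
  exists (x, s); last exact: ballxx.
  split => //= [i|y xy]; last first.
    by apply: (eU y _).1; apply: le_ball xy; rewrite ge_min lexx.
  rewrite -lerBrDr (le_trans _ (_ : `|a - x| <= _))//; last first.
    by rewrite lerBrDr -lerBrDl ge_min lexx orbT.
  rewrite [leRHS]/Num.Def.normr/= mx_normrE.
  by apply: le_trans (le_bigmax _ _ (0, i)); rewrite !mxE.
(* Vitali at level [u / 2] gives the factor 2, and the tripled cubes have volume [(6 * p.2) ^+ n].
   The level is strictly below [u] only for [u != 0]; otherwise the empty family serves. *)
have [F [iF dF FU]] : exists F : seq ('rV[R]_n * R), [/\ forall p, p \in F -> inner p,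
    pairwise (@disjoint_balls _ _) F & u <= 2 * (6 ^+ n * \sum_(p <- F) p.2 ^+ n)].
  have [u00|/eqP u00] := pselect (u = 0).
    by exists [::]; split => //; rewrite big_nil u00 mulr0 mulr0.
  have uu : ((u / 2)%:E < leb U)%E.
    by rewrite uE lte_fin gtr_pMr ?invf_lt1 ?ltr1n// lt_neqAle eq_sym u00.
  have [F [iF dF FU]] := vitali_measure mU coverU uu.
  exists F; split => //.
  move: FU; rewrite (eq_big_seq (fun p => (6 ^+ n * p.2 ^+ n)%:E)); last first.
    move=> p /iF[p0 _ _]; rewrite -exprMn.
    have -> : 6 * p.2 = 2 * (3 * p.2) by rewrite mulrA -natrM.
    by rewrite -(lebesgue_measure_cube p.1)// mulr_gt0.
  by rewrite sumEFin -mulr_sumr lte_fin ltr_pdivrMr// mulrC => /ltW.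
exists (fun k x => \sum_(p <- F) transport (a, r) p k x); split.
- by move=> k; apply: C1_fun_sum => p; exact: C1_fun_transport.
- move=> k x sx; have [p pF px] : exists2 p, p \in F & transport (a, r) p k x != 0.
    apply: contrapT => np; move: sx; rewrite big_seq big1 ?eqxx// => p pF.
    by apply/eqP; apply: contrapT => /negP px; apply: np; exists p.
  exact: (transport_support r0 (iF p pF) px).
- move=> x; apply: (le_trans (euclidean_norm_le _)).
  rewrite -[n in n%:R]card_ord mulr_natl -sumr_const.
  apply: ler_sum => k _; rewrite mxE; exact: (transport_sum_bound r0 k x iF dF).
- apply: le_trans (integral_div_transport r0 oO iF small).
  rewrite -/U uE -EFinM lee_fin.
  have th0 : 0 < 4^-1 ^+ n :> R by rewrite exprn_gt0.
  have s0 : 0 < 6 ^+ n :> R by rewrite exprn_gt0.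
  rewrite -!mulrA ler_wpM2l ?(ltW th0)//.
  rewrite [leLHS]mulrA -invfM mulrC ler_pdivrMr ?mulr_gt0//.
  by apply: (le_trans FU); lra.
Qed.

End cell_existence.

(** * Gluing fields of disjoint cubes into a competitor for the perimeter *)

Section gluing.
Context {R : realType} {n : nat}.
Local Notation leb := (lebesgue_measure_rV R n).

Lemma euclidean_normZ (c : R) (v : 'rV[R]_n) : 0 <= c ->
  euclidean_norm (c *: v) = c * euclidean_norm v.
Proof.
move=> c0; rewrite /euclidean_norm -[in RHS](ger0_norm c0) -sqrtr_sqr -sqrtrM ?sqr_ge0//.
by rewrite mulr_sumr; congr Num.sqrt; apply: eq_bigr => i _; rewrite mxE exprMn.
Qed.

Lemma euclidean_norm0 : euclidean_norm (0 : 'rV[R]_n) = 0.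
Proof. by have := euclidean_normZ 0 (lexx 0); rewrite scale0r mul0r. Qed.

(** At every point at most one of the fields is nonzero, so the weighted sum is admissible as soon
    as each term is on its own cube; nonnegativity of [w] handles the points outside all cubes. *)
Lemma sum_integral_div_le_perimeter (Omega : set 'rV[R]_n) (w : 'rV[R]_n -> \bar R)
    (D : seq ('rV[R]_n * R)) (phi : 'rV[R]_n * R -> 'I_n -> 'rV[R]_n -> R)
    (lam : 'rV[R]_n * R -> R) :
  measurable Omega -> (forall x, 0 <= w x)%E ->
  pairwise (@disjoint_balls _ _) D ->
  (forall p k, C1_fun (phi p k)) ->
  (forall p k x, phi p k x != 0 -> ball p.1 p.2 x) ->
  (forall p, p \in D -> 0 <= lam p /\ forall x, ball p.1 p.2 x ->
    ((lam p * euclidean_norm (\row_k phi p k x))%:E <= w x)%E) ->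
  (\sum_(p <- D) (lam p)%:E * \int[leb]_x (\1_Omega x * div (phi p) x)%:E <=
   perimeter Omega w)%E.
Proof.
move=> mO w0 dD Cphi sphi lamw.
pose psi k x := \sum_(p <- D) lam p * phi p k x.
have Cpsi k : C1_fun (psi k).
  by apply: C1_fun_sum => p; apply: C1_funM => //; exact: C1_fun_cst.
have bphi p k x : phi p k x != 0 -> `|x| <= `|p.1| + p.2.
  move=> /sphi; rewrite -ball_normE/= => px.
  by rewrite -(subrKC p.1 x) (le_trans (ler_normD _ _))// lerD2l distrC ltW.
have spsi k x : psi k x != 0 -> `|x| <= \sum_(p <- D) (`|p.1| + `|p.2|).
  move=> sx; have [p pD px] : exists2 p, p \in D & phi p k x != 0.
    apply: contrapT => np; move: sx; rewrite /psi big_seq big1 ?eqxx// => p pD.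
    apply/eqP; rewrite mulf_eq0; apply/orP; right.
    by apply: contrapT => /negP px; apply: np; exists p.
  apply: (le_trans (bphi _ _ _ px)); rewrite (big_rem p)//= -[leLHS]addr0.
  apply: lerD; last by apply: sumr_ge0 => q _; rewrite addr_ge0.
  by rewrite lerD2l ler_norm.
apply: le_ereal_sup_tmp.
exists (\int[leb]_x (\1_Omega x * divergence (fun x => \row_k psi k x) x)%:E)%E.
  exists (fun x => \row_k psi k x) => //; split; first exact: C1_compact_support_row spsi.
  move=> x; pose F p : 'rV[R]_n := lam p *: \row_k phi p k x.
  have -> : \row_k psi k x = \sum_(p <- D) F p.
    apply/rowP => k; rewrite mxE summxE; apply: eq_bigr => p _.
    by rewrite /F !mxE.
  have FB p : F p != 0 -> ball p.1 p.2 x.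
    move=> Fp; apply: contrapT => npx; move/negP: Fp; apply; apply/eqP/rowP => k.
    rewrite /F !mxE; apply/eqP; rewrite mulf_eq0; apply/orP; right.
    by apply: contrapT => /negP/sphi.
  have dF : {in D &, forall p q, disjoint_balls p q -> F p != 0 -> F q = 0}.
    move=> p q _ _ /asboolP pq /FB px; apply/eqP; apply: contrapT => /negP/FB qx.
    by have : (ball p.1 p.2 `&` ball q.1 q.2) x by []; rewrite pq.
  have [->|[p pD ->]] := pairwise_disjoint_sum dF dD.
  - by rewrite euclidean_norm0.
  - have [l0 lw] := lamw p pD; rewrite euclidean_normZ//.
    have [px|npx] := pselect (ball p.1 p.2 x); first exact: lw.
    have /eqP F0 : F p == 0 by apply: contrapT => /negP/FB.
    by rewrite -euclidean_normZ// -/(F p) F0 euclidean_norm0.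
rewrite divergence_row.
under eq_integral do rewrite /psi div_sum// mulr_sumr -sumEFin.
have ip p : leb.-integrable setT (fun x => (\1_Omega x * div (phi p) x)%:E).
  exact: (integrable_div mO (Cphi p) (bphi p)).
rewrite (eq_integral (fun x =>
    \sum_(p <- D) (lam p)%:E * (\1_Omega x * div (phi p) x)%:E)%E); last first.
  by move=> x _; apply: eq_bigr => p _; rewrite -EFinM mulrCA.
rewrite integral_sum//; last by move=> p; exact: integrableZl.
by apply: lee_sum => p _; rewrite integralZl.
Qed.

End gluing.

(** * Existence of critical cubes *)

Section critical_cubes.
Context {R : realType} {n : nat}.
Local Notation leb := (lebesgue_measure_rV R n).
Implicit Types (mu : {measure set 'rV[R]_n -> \bar R}) (x : 'rV[R]_n).

(** Cubes centred at the origin cover [Omega], and [vitali_measure] at level 0 finds one whose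
    triple has positive mass. *)
Lemma exists_charged_cube mu (Omega : set 'rV[R]_n) : measurable Omega ->
  (0 < mu Omega)%E -> exists2 R0 : R, 0 < R0 & (0 < mu (ball (0%R : 'rV[R]_n) R0))%E.
Proof.
move=> mO mu0.
have cov x : Omega x -> exists2 p : 'rV[R]_n * R, p.1 = 0 /\ 0 < p.2 & ball p.1 p.2 x.
  move=> _; exists (0, `|x| + 1); first by split => //=; rewrite ltr_wpDl.
  by rewrite -ball_normE/= sub0r normrN ltrDl.
have [D [DV _ D0]] := vitali_measure mO cov mu0.
have [p pD pmu] : exists2 p, p \in D & (mu (ball p.1 (3 * p.2)) != 0)%E.
  apply: contrapT => np; move: D0; rewrite big_seq big1 ?ltxx// => p pD.
  by apply/eqP; apply: contrapT => /negP pmu; apply: np; exists p.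
have [p1 p0] := DV p pD; exists (3 * p.2); first by rewrite mulr_gt0.
by rewrite -p1 lt_neqAle eq_sym pmu measure_ge0.
Qed.

(* Among the dyadic multiples of a small radius, the first at which the density
   of [Omega] drops below the threshold. *)
Lemma exists_critical_cube (Omega : set 'rV[R]_n) x (theta K : R) :
  open Omega -> Omega x -> theta < 1 ->
  (forall r, K <= r -> (leb (Omega `&` ball x r) <= (theta * r ^+ n)%:E)%E) ->
  exists r : R, [/\ 0 < r, (leb (Omega `&` ball x r) <= (theta * r ^+ n)%:E)%E &
    ((theta * (r / 2) ^+ n)%:E <= leb (Omega `&` ball x r))%E].
Proof.
move=> oO Ox th1 dens.
have mOB r : measurable (Omega `&` ball x r).
  by apply: measurableI; [exact: open_measurable_rV|exact: measurable_cube].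
have [s /= s0 sO] : nbhs_ball x Omega by apply/nbhs_ballP; exact: open_nbhs_nbhs.
pose P k := (leb (Omega `&` ball x (s * 2 ^+ k)) <= (theta * (s * 2 ^+ k) ^+ n)%:E)%E.
have exP : exists k, P k.
  pose k := Num.truncn (K / s); exists k.+1; apply: dens.
  have : K / s < k.+1%:R by exact: truncnS_gt.
  rewrite ltr_pdivrMr// mulrC => /ltW/le_trans; apply.
  by rewrite ler_wpM2l ?(ltW s0)// -natrX ler_nat ltnW// ltn_expl.
(* At the starting radius the cube lies in [Omega], with volume [(2 * s) ^+ n], which exceeds
   [theta * s ^+ n]. *)
have P0 : ~~ P 0%N.
  rewrite /P expr0 mulr1 -ltNge (_ : _ `&` _ = ball x s); last exact/setIidPr.
  rewrite lebesgue_measure_cube// lte_fin.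
  have sn0 : 0 < s ^+ n by rewrite exprn_gt0.
  rewrite (lt_le_trans (_ : _ < s ^+ n))//; first by rewrite gtr_pMl.
  by rewrite exprMn ler_peMl ?(ltW sn0)// exprn_ege1// ler1n.
case: (ex_minnP exP) => -[|k] Pk kmin; first by rewrite Pk in P0.
exists (s * 2 ^+ k.+1); split => //; first by rewrite mulr_gt0// exprn_gt0.
rewrite exprSr mulrA mulfK//.
have /negP : ~ P k by move=> /kmin; rewrite ltnn.
rewrite -ltNge => /ltW/le_trans; apply; apply: le_measure; rewrite ?inE//.
apply: setIS; apply: le_ball; rewrite ler_peMr// ?ler1n//.
by rewrite mulr_ge0 ?exprn_ge0// ltW.
Qed.

End critical_cubes.

(** * The global estimate *)

Section main_estimate.
Context {R : realType} {n : nat}.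
Local Notation leb := (lebesgue_measure_rV R n).

(** By contradiction: if [mu Omega] exceeds [c^-1] times the perimeter, [vitali_measure] at that
    level yields disjoint critical cubes whose triples have total mass above it, while the glued
    field bounds this mass by the same level. The negation also provides [mu Omega > 0], from which
    a charged cube is obtained. *)
Lemma measure_le_perimeter : (0 < n)%N -> exists2 C : R, 0 < C &
  forall mu : {measure set 'rV[R]_n -> \bar R}, locally_finite_measure mu ->
  forall Omega : set 'rV[R]_n, open Omega -> finite_perimeter Omega (M1 mu) ->
  (mu Omega <= C%:E * perimeter Omega (M1 mu))%E.
Proof.
move=> n0; pose theta : R := 4^-1 ^+ n / 2.
pose kappa : R := 4^-1 ^+ n / 4 / 6 ^+ n.
(* The product of the coefficient in [lam], the isoperimetric constant [kappa] and the density bound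
   at half radius, with the powers of the radius cancelled. *)
pose c : R := 4 / (8 * n%:R) ^+ n * kappa * (theta / 2 ^+ n).
have fourn : 0 < 4^-1 ^+ n :> R by rewrite exprn_gt0.
have th0 : 0 < theta by rewrite divr_gt0.
have th1 : theta < 1.
  have : 4^-1 ^+ n <= 1 :> R by rewrite exprn_ile1// invf_le1// ler1n.
  by rewrite /theta; lra.
have k0 : 0 < kappa by rewrite !divr_gt0// exprn_gt0.
have nn0 : 0 < n%:R :> R by rewrite ltr0n.
have c0 : 0 < c by rewrite !mulr_gt0// ?invr_gt0 ?exprn_gt0// mulr_gt0.
exists c^-1; first by rewrite invr_gt0.
move=> mu lfmu Omega oO [mO [[_ Ifin] _]].
have M10 x : (0 <= M1 mu x)%E.
  have := @M1_ge R n mu set0 x 1 ltr01 measurable0 (@sub0set _ _).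
  by rewrite measure0 mule0.
have per0 : (0 <= perimeter Omega (M1 mu))%E.
  (* The empty family of cubes is the zero competitor. *)
  have := @sum_integral_div_le_perimeter R n Omega (M1 mu) [::] (fun _ _ _ => 0) (fun=> 0)
    mO M10 isT.
  rewrite big_nil; apply => // [_ _|p k x]; first exact: C1_fun_cst.
  by rewrite eqxx.
rewrite leNgt; apply/negP => tmu.
have mu0 : (0 < mu Omega)%E.
  by apply: le_lt_trans tmu; rewrite mule_ge0// lee_fin invr_ge0 ltW.
have [R0 R00 chR0] := exists_charged_cube mO mu0.
pose V (p : 'rV[R]_n * R) := [/\ 0 < p.2,
  (leb (Omega `&` ball p.1 p.2) <= (theta * p.2 ^+ n)%:E)%E &
  ((theta * (p.2 / 2) ^+ n)%:E <= leb (Omega `&` ball p.1 p.2))%E].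
have cov x : Omega x -> exists2 p, V p & ball p.1 p.2 x.
  move=> Ox; have [K KP] := density_le x n0 R00 chR0 mO Ifin th0.
  have [r [r0 r1 r2]] := exists_critical_cube oO Ox th1 KP.
  by exists (x, r) => //; exact: ballxx.
have [D [DV dD]] := vitali_measure mO cov tmu.
pose m p : R := fine (mu (ball p.1 (3 * p.2))).
have mE p : (mu (ball p.1 (3 * p.2)) = (m p)%:E)%E.
  rewrite fineK// ge0_fin_numE//.
  apply: le_lt_trans (lfmu _ (@compact_norm_le R n (`|p.1| + 3 * p.2))).
  apply: le_measure; rewrite ?inE.
  - exact: measurable_cube.
  - rewrite -[X in measurable X]setCK; apply: measurableC; apply: open_measurable_rV.
    by apply: closed_openC; exact: closed_norm_le.
  - move=> x /=; rewrite -ball_normE/= => px.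
    by rewrite -(subrKC p.1 x) (le_trans (ler_normD _ _))// lerD2l distrC ltW.
have m0 p : 0 <= m p by rewrite -lee_fin -mE.
apply/negP; rewrite -leNgt; under eq_bigr do rewrite mE.
have /choice[phi phiP] (p : 'rV[R]_n * R) : exists f : 'I_n -> 'rV[R]_n -> R, [/\
    forall k, C1_fun (f k), forall k x, f k x != 0 -> ball p.1 p.2 x &
    V p -> (forall x, euclidean_norm (\row_k f k x) <= n%:R * p.2) /\
    (kappa%:E * leb (Omega `&` ball p.1 p.2) <=
      \int[leb]_x (\1_Omega x * div f x)%:E)%E].
  have [[p0 p1 _]|nV] := pselect (V p).
    by have [f [? ? ? ?]] := relative_isoperimetry p0 oO p1; exists f.
  (* The zero field for cubes outside [V] makes regularity and support hold for all [p], as gluing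
     requires. *)
  exists (fun _ _ => 0); split => // [k|k x]; first exact: C1_fun_cst.
  by rewrite eqxx.
(* Chosen so that [lam p * (n * p.2)] is exactly the lower bound of [M1_ge] at radius [4 * n * p.2]
   for the mass of the tripled cube. *)
pose lam (p : 'rV[R]_n * R) := 4 / (8 * n%:R * p.2) ^+ n * m p.
have lam0 p : V p -> 0 <= lam p.
  move=> [p0 _ _]; by rewrite mulr_ge0// divr_ge0// exprn_ge0// !mulr_ge0// ltW.
have per := @sum_integral_div_le_perimeter R n Omega (M1 mu) D phi lam mO M10 dD.
rewrite sumEFin lee_pdivlMl// -EFinM; apply: (le_trans _ (per _ _ _)); last 3 first.
- by move=> p k; case: (phiP p).
- by move=> p k x; case: (phiP p) => _ sp _; exact: sp.
- move=> p /DV Vp; have [p0 _ _] := Vp; have [_ _ /(_ Vp)[np _]] := phiP p.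
  split=> [|x px]; first exact: lam0.
  apply: (@le_trans _ _ (lam p * (n%:R * p.2))%:E).
    by rewrite lee_fin ler_wpM2l// lam0.
  (* From any point of the cube, the concentric triple lies within sup-distance [4 * p.2]; the
     factor [n] passes to the Euclidean ball. *)
  have rho0 : 0 < n%:R * (4 * p.2) by rewrite !mulr_gt0.
  apply: le_trans (@M1_ge R n mu (ball p.1 (3 * p.2)) x _ rho0 _ _).
  + rewrite mE -EFinM lee_fin le_eqVlt; apply/orP; left; apply/eqP.
    rewrite /lam (_ : 2 * (n%:R * (4 * p.2)) = 8 * n%:R * p.2); last by ring.
    by ring.
  + exact: measurable_cube.
  + move=> y py; apply: cube_sub_euclidean_ball => //.
    rewrite (_ : 4 * p.2 = p.2 + 3 * p.2); last by ring.
    by apply: ball_triangle py; exact: ball_sym.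
rewrite mulr_sumr -sumEFin big_seq [leRHS]big_seq; apply: lee_sum => p /DV Vp.
have [p0 _ p2] := Vp; have [_ _ /(_ Vp)[_ ip]] := phiP p.
apply: (@le_trans _ _ ((lam p)%:E * (kappa%:E * (theta * (p.2 / 2) ^+ n)%:E))%E); last first.
  rewrite lee_wpmul2l// ?lee_fin ?lam0//; apply: le_trans ip.
  by rewrite lee_wpmul2l// lee_fin ltW.
rewrite -!EFinM lee_fin le_eqVlt; apply/orP; left; apply/eqP.
rewrite /c /lam expr_div_n [(8 * n%:R * p.2) ^+ n]exprMn.
have pn0 : 0 < p.2 ^+ n by rewrite exprn_gt0.
have en0 : 0 < (8 * n%:R) ^+ n :> R by rewrite exprn_gt0// mulr_gt0.
have tn0 : 0 < 2 ^+ n :> R by rewrite exprn_gt0.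
have scale (k t q a b e : R) : a != 0 -> b != 0 -> e != 0 ->
    4 / b * k * (t / e) * q = 4 / (b * a) * q * (k * (t * (a / e))).
  by move=> a0 b0 e0; field; rewrite a0 b0 e0.
by apply: scale; rewrite gt_eqF.
Qed.

End main_estimate.

Theorem corollary2p5 (R : realType) (n : nat) (hn : (2 <= n)%N) :
  exists C : \bar R -> R, (forall a : \bar R, 0 < C a) /\
    forall mu : {measure set 'rV[R]_n -> \bar R},
      locally_finite_measure mu ->
      (exists x0 : 'rV[R]_n, (M1 mu x0 < +oo)%E) ->
      forall Omega : set 'rV[R]_n,
        open Omega ->
        finite_perimeter Omega (M1 mu) ->
        (mu Omega <= (C (A1_constant (M1 mu)))%:E * perimeter Omega (M1 mu))%E.
Proof.
have [C C0 CP] := @measure_le_perimeter R n (ltnW hn).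
by exists (fun=> C); split=> // mu lfmu _ Omega; exact: CP.
Qed.
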